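(* Let $\alpha\in(0,2]$. There exist a constant $C(\alpha)>0$ depending only on $\alpha$ and an absolute constant $C>0$ such that the following holds. Let $A\in\mathbb{R}^{m\times n}$ be a random matrix whose columns $A_i$ are independent, mean-zero random vectors in $\mathbb{R}^m$. Assume that $\|A_i\|_2=1$ almost surely for every $i$ and that the columns have $\psi_\alpha$-norm (quasi-norm when $\alpha<1$) bounded by $K$. Let $T\subset\mathbb{R}^n$ be a bounded set. Then $$\mathbb{E}\sup_{x\in T}\Bigl|\|Ax\|_2-\|x\|_2\Bigr|\le C(\alpha)K\bigl(\gamma_\alpha(T)+\mathrm{rad}(T)\bigr).$$ Moreover, for any $u\ge0$, with probability at least $1-Ce^{-u^\alpha}$, $$\sup_{x\in T}\Bigl|\|Ax\|_2-\|x\|_2\Bigr|\le C(\alpha)K\bigl(\gamma_\alpha(T)+u\cdot\mathrm{rad}(T)\bigr).$$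
   Context: For a real random variable $\xi$ and $\alpha>0$, $\|\xi\|_{\psi_\alpha}:=\inf\{t>0:\mathbb{E}\exp(|\xi/t|^\alpha)\le 2\}$. For a random vector $\xi$ in $\mathbb{R}^m$, $\|\xi\|_{\psi_\alpha}:=\sup_{x\in S^{m-1}}\|\langle\xi,x\rangle\|_{\psi_\alpha}$. $\mathrm{rad}(T):=\sup_{t\in T}\|t\|_2$. Talagrand's functional: an admissible sequence of partitions of $T$ is an increasing sequence $(\mathcal{A}_k)_{k\ge0}$ of partitions of $T$ (each $\mathcal{A}_{k+1}$ refines $\mathcal{A}_k$) with $|\mathcal{A}_0|=1$ and $|\mathcal{A}_k|\le 2^{2^k}$ for $k\ge1$. For $t\in T$, $A_k(t)$ is the unique element of $\mathcal{A}_k$ containing $t$. Then $$\gamma_\alpha(T):=\inf\sup_{t\in T}\sum_{k\ge0}2^{k/\alpha}\Delta(A_k(t)),$$ where the infimum is over all admissible sequences and $\Delta(S)=\sup_{s,t\in S}\|s-t\|_2$ is the Euclidean diameter. *)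

(* Defs.v *)
From HB Require Import structures.
From mathcomp Require Import all_boot all_order all_algebra.
From mathcomp Require Import all_classical all_reals all_analysis.
Import Order.TTheory GRing.Theory Num.Theory.
Import numFieldNormedType.Exports.

Set Implicit Arguments.
Unset Strict Implicit.
Unset Printing Implicit Defensive.

Local Open Scope classical_set_scope.
Local Open Scope ring_scope.

Section Euclidean.
Context {R : realType} {n : nat}.
Implicit Types (x y : 'cV[R]_n) (S T : set 'cV[R]_n).

Definition dotv x y : R := \sum_(i < n) x i 0 * y i 0.

(* The norm [`|x|] that MathComp-Analysis puts on matrices is the sup norm. *)
Definition l2norm x : R := Num.sqrt (dotv x x).

Definition unit_sphere : set 'cV[R]_n := [set x | l2norm x = 1].

Definition l2rad T : \bar R := ereal_sup [set (l2norm t)%:E | t in T].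

Definition diam S : \bar R :=
  ereal_sup [set (l2norm (s - t))%:E | s in S & t in S].

End Euclidean.

Section Talagrand.
Context {R : realType} {n : nat}.
Implicit Types (T : set 'cV[R]_n) (Ak : nat -> set (set 'cV[R]_n)).

Definition admissible T Ak : Prop :=
  [/\ forall k, partition (Ak k) id T,
      forall k S, Ak k.+1 S -> exists2 S', Ak k S' & S `<=` S',
      (Ak 0%N #= `I_1)%card &
      forall k, (1 <= k)%N -> (Ak k #<= `I_(2 ^ (2 ^ k)))%card].

(* [pblock (Ak k) id t] is the block of the partition [Ak k] containing [t]. *)
Definition gamma (alpha : R) T : \bar R :=
  ereal_inf [set ereal_sup
      [set (\sum_(0 <= k <oo)
              (2 `^ (k%:R / alpha))%:E * diam (pblock (Ak k) id t))%E
      | t in T]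
    | Ak in admissible T].

End Talagrand.

Section Random.
Context {R : realType} {d : measure_display} {Omega : measurableType d}.
Variable P : probability Omega R.

(* The infimum of the empty set is [+oo]. *)
Definition psi_norm (alpha : R) (X : Omega -> R) : \bar R :=
  ereal_inf [set t%:E | t in
    [set t : R | 0 < t /\
      ('E_P[fun w => expR (`|X w / t| `^ alpha)%R] <= 2%:E)%E]].

Definition psi_norm_vec (m : nat) (alpha : R) (X : Omega -> 'cV[R]_m) : \bar R :=
  ereal_sup [set psi_norm alpha (fun w => dotv (X w) x) | x in unit_sphere].

(* The sigma-algebra generated by the coordinates, i.e. the Borel
   sigma-algebra of R^m. *)
Definition borel_cV (m : nat) : set (set 'cV[R]_m) :=
  g_sigma_preimage (fun (j : 'I_m) (v : 'cV[R]_m) => v j 0).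

Definition random_matrix (m n : nat) (A : Omega -> 'M[R]_(m, n)) : Prop :=
  forall j i, measurable_fun setT (fun w => A w j i).

Definition independent_vectors (m n : nat) (X : 'I_n -> Omega -> 'cV[R]_m) : Prop :=
  forall (J : {set 'I_n}) (B : 'I_n -> set 'cV[R]_m),
    (forall i, i \in J -> borel_cV (B i)) ->
    P (\bigcap_(i in [set` J]) (X i @^-1` B i)) =
    (\prod_(i in J) P (X i @^-1` B i))%E.

End Random.

Definition sup_deviation {R : realType} {m n : nat} (M : 'M[R]_(m, n))
    (T : set 'cV[R]_n) : \bar R :=
  ereal_sup [set (`|l2norm (M *m x) - l2norm x|)%:E | x in T].

(* Main.v *)
(* The increment of the deviation |Ax| - |x| between x and y has L^(2k) norm of
   order K k^(1/alpha) |x - y|, so generic chaining applies.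

   The moments of the increments reduce to those of the off-diagonal Gram form
   sum_(i <> j) u_i v_j <A_i, A_j>.  Averaging over all subsets I of columns
   decouples it into sum_(i in I) u_i <A_i, w> with w = sum_(j notin I) v_j A_j.
   Its even moments are bounded by integrating out the columns of I one by one:
   in (s + x)^(2k) the term linear in x has mean zero, the other odd terms are
   absorbed by the even ones, and because alpha <= 2 the psi_alpha moments make
   the resulting recursion a binomial expansion.  What is left is a moment of |w|,
   that is, of |Av| for a restriction v, which the same estimate bounds by a
   self-improving inequality. *)
Require Import Defs.
From HB Require Import structures.
From mathcomp Require Import all_boot all_order all_algebra.
From mathcomp Require Import all_classical all_reals all_analysis.
From mathcomp Require Import measurable_realfun ring lra zify.
Import Order.TTheory GRing.Theory Num.Theory.
Import numFieldNormedType.Exports.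

Set Implicit Arguments.
Unset Strict Implicit.
Unset Printing Implicit Defensive.

Local Open Scope classical_set_scope.
Local Open Scope ring_scope.

(** * Inequalities for even powers *)

(** Even moments replace exponential moments because for [alpha < 1] a psi_alpha bound does not
    control a Laplace transform; moments also use independence through Fubini only, one column at a
    time. The bound propagated is (2k)!/k! times (theta |u|^2)^k: the identity C(2k,2l) (2l)!/l!
    (2k-2l)!/(k-l)! = (2k)!/k! C(k,l) turns the peeling step into the binomial theorem for theta
    u_i^2 + theta |u'|^2, so nothing is lost per column and the constants are free of [n].

    A second obstacle is that |Ax| is not polynomial in A. Dividing the difference of squares by
    |Ax| + |Ay| is safe only if |Ax| is not small; for a unit x with |Ax| < 1/2 the Gram excess of x
    is at least 3/4 in absolute value, so a high moment of it pays for that event, at the price of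
    moments of double order.

    Chaining level j uses order 2k with k = 2^(j+1): Markov gives exp(-2^(j+2)) against 2^(2^(j+1))
    links. Starting the chain at level l gives the tail at u of order 2^(l/alpha); the expectation
    comes from the first level at which chaining succeeds, not from integrating the tail. *)

Lemma sum_even_odd (V : zmodType) (a : nat -> V) (k : nat) :
  \sum_(i < k.*2.+1) a i =
  \sum_(l < k.+1) a l.*2 + \sum_(l < k) a l.*2.+1.
Proof.
elim: k => [|k IH]; first by rewrite big_ord0 !big_ord1 addr0.
rewrite doubleS big_ord_recr big_ord_recr IH [in RHS]big_ord_recr.
rewrite [X in _ = _ + X]big_ord_recr /= doubleS -!addrA; congr (_ + _).
by rewrite [RHS]addrC -addrA.
Qed.

(** The ratio of the square to the product of the neighbours is (j+2)(n-j) / ((j+1)(n-j-1)), and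
    (j+2)/(j+1) and (n-j)/(n-j-1) are both at most 2. The constant 4 is exactly what a discriminant
    condition asks for. *)
Lemma bin_sqr_le (n j : nat) : (j.+1 < n)%N ->
  ('C(n, j.+1) ^ 2 <= 4 * ('C(n, j) * 'C(n, j.+2)))%N.
Proof.
move=> jn.
have e1 := mul_bin_left n j; have e2 := mul_bin_left n j.+1.
have h : (j.+2 * (n - j) <= 4 * (j.+1 * (n - j.+1)))%N by nia.
have p : (0 < j.+1 * (n - j.+1))%N by lia.
rewrite -(leq_pmul2l p).
have -> : (j.+1 * (n - j.+1) * 'C(n, j.+1) ^ 2 =
   'C(n, j) * 'C(n, j.+2) * (j.+2 * (n - j)))%N.
  have -> : (j.+1 * (n - j.+1) * 'C(n, j.+1) ^ 2 =
    (j.+1 * 'C(n, j.+1)) * ((n - j.+1) * 'C(n, j.+1)))%N by rewrite expnS expn1; lia.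
  by rewrite e1 -e2; lia.
by rewrite (leq_trans (leq_mul (leqnn _) h))//; lia.
Qed.

(** Dividing out the nonnegative even monomial [s ^+ N * x ^+ j.*2.+2] leaves [c1 * (s * x) <= c0 *
    s ^+ 2 + c2 * x ^+ 2], a quadratic form whose discriminant is controlled by [bin_sqr_le]. *)
Lemma odd_term_le (R : realFieldType) (n j : nat) (s x : R) :
  (j.*2.+2 < n)%N -> ~~ odd n ->
  s ^+ (n - j.*2.+3) * x ^+ j.*2.+3 *+ 'C(n, j.*2.+3) <=
  s ^+ (n - j.*2.+2) * x ^+ j.*2.+2 *+ 'C(n, j.*2.+2) +
  s ^+ (n - j.*2.+4) * x ^+ j.*2.+4 *+ 'C(n, j.*2.+4).
Proof.
move=> jn on.
have jn' : (j.*2.+4 <= n)%N.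
  rewrite ltn_neqAle jn andbT; apply: contra on => /eqP <-.
  by rewrite /= odd_double.
have e3 : (n - j.*2.+3 = (n - j.*2.+4).+1)%N by lia.
have e2 : (n - j.*2.+2 = (n - j.*2.+4).+2)%N by lia.
rewrite e3 e2 -[leLHS]mulr_natl -[X in _ <= X + _]mulr_natl -[X in _ <= _ + X]mulr_natl.
have := bin_sqr_le (n := n) (j := j.*2.+2) jn'.
rewrite -(ler_nat R) natrX !natrM.
move: ('C(n, j.*2.+2)%:R : R) (ler0n R 'C(n, j.*2.+2)) => c0 c00.
move: ('C(n, j.*2.+3)%:R : R) (ler0n R 'C(n, j.*2.+3)) => c1 c10.
move: ('C(n, j.*2.+4)%:R : R) (ler0n R 'C(n, j.*2.+4)) => c2 c20 h.
have ev : ~~ odd (n - j.*2.+4) by rewrite oddB//= odd_double (negbTE on).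
set N := (n - j.*2.+4)%N in ev *.
have p0 : 0 <= s ^+ N * x ^+ j.*2.+2.
  by rewrite mulr_ge0// exprn_even_ge0//= odd_double.
suff H : c1 * (s * x) <= c0 * s ^+ 2 + c2 * x ^+ 2.
  have := ler_wpM2l p0 H.
  set e := s ^+ N; set f := x ^+ j.*2.+2.
  have -> : e * f * (c1 * (s * x)) = c1 * (s ^+ N.+1 * x ^+ j.*2.+3).
    have -> : s ^+ N.+1 = s * e by rewrite /e -!exprS.
    have -> : x ^+ j.*2.+3 = x * f by rewrite /f -!exprS.
    by ring.
  have -> : e * f * (c0 * s ^+ 2 + c2 * x ^+ 2) =
     c0 * (s ^+ N.+2 * f) + c2 * (e * x ^+ j.*2.+4).
    have -> : s ^+ N.+2 = s * (s * e) by rewrite /e -!exprS.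
    have -> : x ^+ j.*2.+4 = x * (x * f) by rewrite /f -!exprS.
    by ring.
  by [].
have [c0p|] := ltP 0 c0; last first.
  move=> c0n; have c0E : c0 = 0 by apply/eqP; rewrite eq_le c0n.
  have c1E : c1 = 0.
    by apply/eqP; rewrite -sqrf_eq0 eq_le sqr_ge0 andbT; move: h; rewrite c0E mul0r mulr0.
  by rewrite c0E c1E !mul0r add0r mulr_ge0// sqr_ge0.
rewrite -(ler_pM2l (mulr_gt0 (ltr0n R 4) c0p)).
have q1 : 0 <= (2 * c0 * s - c1 * x) ^+ 2 by exact: sqr_ge0.
have q2 : 0 <= (4 * (c0 * c2) - c1 ^+ 2) * x ^+ 2.
  by rewrite mulr_ge0 ?sqr_ge0// subr_ge0.
by nra.
Qed.

(* The linear term is kept apart because it integrates to zero; every other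
   odd term is absorbed by its two even neighbours. *)
Lemma exprD_even_le (R : realFieldType) (k : nat) (s x : R) :
  (s + x) ^+ k.*2 <= k.*2%:R * x * s ^+ k.*2.-1 +
    \sum_(l < k.+1) 'C(k.*2, l.*2)%:R * 3 ^+ l * x ^+ l.*2 * s ^+ (k - l).*2.
Proof.
case: k => [|k]; first by rewrite big_ord1 bin0 /= !expr0 !mul0r !mulr1 add0r.
rewrite exprDn.
pose a i : R := s ^+ (k.+1.*2 - i) * x ^+ i *+ 'C(k.+1.*2, i).
rewrite (sum_even_odd a) big_ord_recl [X in _ + X]big_ord_recl /=.
rewrite [X in _ <= _ + X]big_ord_recl /=.
have a1E : a 1%N = k.+1.*2%:R * x * s ^+ k.+1.*2.-1.
  by rewrite /a bin1 subn1 -mulr_natl expr1; ring.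
have a0E : a 0%N = 'C(k.+1.*2, 0)%:R * 3 ^+ 0 * x ^+ 0 * s ^+ (k.+1 - 0).*2.
  by rewrite /a !bin0 !subn0 -mulr_natl !expr0; ring.
have a_ge0 l : (l <= k.+1)%N -> 0 <= a l.*2.
  move=> lk; rewrite /a mulrn_wge0// -doubleB mulr_ge0// exprn_even_ge0//.
  - by rewrite odd_double.
  - by rewrite odd_double.
have H1 : \sum_(i < k) a (lift ord0 i).*2.+1 <=
          \sum_(i < k) a i.+1.*2 + \sum_(i < k) a i.+2.*2.
  rewrite -big_split/=; apply: ler_sum => i _; rewrite /bump /= add1n !doubleS.
  apply: odd_term_le; last by rewrite /= odd_double.
  by move: (ltn_ord i); lia.
have H2 : \sum_(i < k) a i.+1.*2 <= \sum_(i < k.+1) a i.+1.*2.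
  by rewrite [leRHS]big_ord_recr/= lerDl a_ge0.
have H3 : \sum_(i < k) a i.+2.*2 <= \sum_(i < k.+1) a i.+1.*2.
  by rewrite [leRHS]big_ord_recl/= lerDr a_ge0.
(* An even term of positive index counts once for itself and at most once for each odd neighbour,
   hence the 3. It is relaxed to [3 ^+ l], possible since l is at least 1 here, so that it can later
   be merged into [theta ^+ l]. *)
have H4 : 3 * \sum_(i < k.+1) a i.+1.*2 <=
   \sum_(i < k.+1) 'C(k.+1.*2, (lift ord0 i).*2)%:R * 3 ^+ (lift ord0 i) *
      x ^+ (lift ord0 i).*2 * s ^+ (k.+1 - (lift ord0 i)).*2.
  rewrite mulr_sumr; apply: ler_sum => i _.
  have -> : (lift ord0 i : nat) = i.+1 by [].
  have -> : 'C(k.+1.*2, i.+1.*2)%:R * 3 ^+ i.+1 *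
      x ^+ i.+1.*2 * s ^+ (k.+1 - i.+1).*2 = 3 ^+ i.+1 * a i.+1.*2.
    rewrite /a -doubleB -mulr_natl; ring.
  rewrite ler_wpM2r ?a_ge0 ?ltn_ord//.
  by rewrite exprS ler_peMr// exprn_ege1// ler1n.
have -> : \sum_(i < k.+1) a (lift ord0 i).*2 = \sum_(i < k.+1) a i.+1.*2.
  by apply: eq_bigr => i _.
rewrite -/(a 0%N) -/(a 1%N) a1E a0E; move: H1 H2 H3 H4.
by move: (bigop _ _ _) (bigop _ _ _) (bigop _ _ _) (bigop _ _ _) (bigop _ _ _) => *; lra.
Qed.

(** Since [j.*2 ^_ j] is (2j)!/j!, both sides equal (2k)!/(l! (k-l)!). This is what closes the
    induction of [decoupled_moment_le]. *)
Lemma bin_double_ffact (k l : nat) : (l <= k)%N ->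
  ('C(k.*2, l.*2) * (l.*2 ^_ l * (k - l).*2 ^_ (k - l)) =
   k.*2 ^_ k * 'C(k, l))%N.
Proof.
move=> lk; have f j : (j.*2 ^_ j * j`! = j.*2`!)%N.
  by have := @ffact_fact j.*2 j; rewrite -addnn addnK leq_addr => ->.
have p : (0 < l`! * (k - l)`!)%N by rewrite muln_gt0 !fact_gt0.
apply/eqP; rewrite -(eqn_pmul2r p); apply/eqP.
transitivity (k.*2`!).
  rewrite -(@bin_fact k.*2 l.*2) ?leq_double// -doubleB -!f; lia.
by rewrite -!mulnA bin_fact// f.
Qed.

(** With [ffact_le_expn] this places (2l)!/l! between l^l and (2l)^l: the lower bound absorbs the
    growth of the psi_alpha moments, the upper bound returns to powers at the end. *)
Lemma expn_le_ffact_double (l : nat) : (l ^ l <= l.*2 ^_ l)%N.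
Proof.
have : forall m, (l ^ m <= (l + m) ^_ m)%N.
  elim=> [|m IH]; first by rewrite ffactn0.
  by rewrite addnS ffactnS expnS leq_mul//= -addnS leq_addr.
by move=> /(_ l); rewrite addnn.
Qed.

Lemma ffact_le_expn (n m : nat) : (n ^_ m <= n ^ m)%N.
Proof.
elim: m n => [|m IH] n; first by rewrite ffactn0.
rewrite ffactnS expnS leq_mul// (leq_trans (IH _))//.
by case: (m) => // p; rewrite leq_exp2r// leq_pred.
Qed.

Section RealInequalities.
Variable R : realFieldType.
Implicit Types x y z m : R.

Lemma exprn_even_doublege0 x k : 0 <= x ^+ k.*2.
Proof. by rewrite exprn_even_ge0// odd_double. Qed.

Lemma expr_double x k : x ^+ k.*2 = (x ^+ 2) ^+ k.
Proof. by rewrite -exprM mul2n. Qed.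

Lemma exprn_tangent_le m z n : 0 <= m -> 0 <= z ->
  m ^+ n.+1 + n.+1%:R * m ^+ n * (z - m) <= z ^+ n.+1.
Proof.
move=> m0 z0; elim: n => [|n IH]; first by rewrite expr0 !expr1; lra.
have h1 := ler_wpM2l z0 IH.
have h2 : 0 <= n.+1%:R * m ^+ n * (z - m) ^+ 2.
  by rewrite mulr_ge0 ?sqr_ge0// mulr_ge0// exprn_ge0.
rewrite (exprS z) (le_trans _ h1)// -subr_ge0.
rewrite [X in 0 <= X](_ : _ = n.+1%:R * m ^+ n * (z - m) ^+ 2)//.
by rewrite !(exprS m) -[n.+2]addn1 natrD; ring.
Qed.

(** Jensen's inequality: the tangent lines at the mean [m] are summed, and their linear parts
    cancel. *)
Lemma mean_exprn_le (I : finType) (z : I -> R) n : (0 < #|I|)%N ->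
  (forall i, 0 <= z i) ->
  ((\sum_i z i) / #|I|%:R) ^+ n.+1 <= (\sum_i z i ^+ n.+1) / #|I|%:R.
Proof.
move=> I0 z0; set m := _ / _.
have I0' : 0 < #|I|%:R :> R by rewrite ltr0n.
have m0 : 0 <= m by rewrite divr_ge0 ?sumr_ge0// ltW.
rewrite ler_pdivlMr//.
apply: (@le_trans _ _ (\sum_i (m ^+ n.+1 + n.+1%:R * m ^+ n * (z i - m)))).
  rewrite big_split/= -mulr_sumr sumrB !sumr_const.
  have -> : \sum_i z i = m * #|I|%:R by rewrite /m mulfVK// gt_eqF.
  by rewrite !mulr_natr subrr mulr0 addr0.
by apply: ler_sum => i _; apply: exprn_tangent_le.
Qed.

Lemma mean_exprn_double_le (I : finType) (z : I -> R) k : (0 < #|I|)%N ->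
  ((\sum_i z i) / #|I|%:R) ^+ k.*2 <= (\sum_i z i ^+ k.*2) / #|I|%:R.
Proof.
move=> I0; case: k => [|k].
  rewrite !expr0 (eq_bigr (fun=> 1)) => [|i _]; last by rewrite expr0.
  by rewrite sumr_const divff// gt_eqF// ltr0n.
have e x : x ^+ k.+1.*2 = `|x| ^+ k.+1.*2.
  by rewrite [RHS]expr_double real_normK ?num_real// -expr_double.
rewrite [X in _ <= X / _](eq_bigr (fun i => `|z i| ^+ k.+1.*2)) => [|i _]; last exact: e.
rewrite [leLHS]e (le_trans _ (mean_exprn_le _ I0 (fun i => normr_ge0 (z i))))//.
rewrite lerXn2r ?nnegrE ?divr_ge0 ?sumr_ge0//.
by rewrite normrM normfV normr_nat ler_wpM2r ?invr_ge0// ler_norm_sum.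
Qed.

Lemma exprnD_le x y n : 0 <= x -> 0 <= y ->
  (x + y) ^+ n <= 2 ^+ n * (x ^+ n + y ^+ n).
Proof.
move=> x0 y0; wlog xy : x y x0 y0 / x <= y.
  move=> H; have [/H|/ltW/H] := leP x y; first exact.
  by rewrite addrC [X in _ * X]addrC; apply.
apply: (@le_trans _ _ ((2 * y) ^+ n)).
  by rewrite lerXn2r ?nnegrE; lra.
by rewrite exprMn ler_wpM2l ?exprn_ge0// lerDr exprn_ge0.
Qed.

Lemma exprn_doubleD_le x y k :
  (x + y) ^+ k.*2 <= 4 ^+ k * (x ^+ k.*2 + y ^+ k.*2).
Proof.
have s2 z : z ^+ k.*2 = `|z| ^+ k.*2.
  by rewrite [RHS]expr_double real_normK ?num_real// -expr_double.
rewrite (s2 x) (s2 y) (s2 (x + y)) (_ : 4 ^+ k = 2 ^+ k.*2); last first.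
  by rewrite expr_double expr2 -natrM.
apply: le_trans (exprnD_le _ (normr_ge0 x) (normr_ge0 y)).
by rewrite lerXn2r ?nnegrE ?addr_ge0// ler_normD.
Qed.

End RealInequalities.

(** A set is a choice of a boolean for each index; the choices at [i] and [j] are forced and the
    other n - 2 are free. [F] encodes the constraint as a product over indices, so that the sum over
    all sets factors. *)
Lemma card_separating_sets n (i j : 'I_n) : i != j ->
  (4 * \sum_(I : {set 'I_n}) (i \in I) * (j \notin I) = 2 ^ n)%N.
Proof.
move=> ij.
pose F (l : 'I_n) (b : bool) : nat := if l == i then b else if l == j then ~~ b else true.
have -> : (\sum_(I : {set 'I_n}) (i \in I) * (j \notin I) =
    \sum_(f : {ffun 'I_n -> bool}) \prod_l F l (f l))%N.
  pose h (f : {ffun 'I_n -> bool}) : {set 'I_n} := [set l | f l]%SET.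
  rewrite (reindex h) /=; last first.
    exists (fun I : {set 'I_n} => [ffun l => l \in I]) => [f _|I _].
      by apply/ffunP => l; rewrite ffunE inE.
    by apply/setP => l; rewrite inE ffunE.
  apply: eq_bigr => f _; rewrite (bigD1 i)//= (bigD1 j) /=; last by rewrite eq_sym.
  rewrite big1 => [|l /andP[/negbTE li /negbTE lj]]; last by rewrite /F li lj.
  by rewrite /F eqxx eq_sym (negbTE ij) eqxx /h !inE muln1.
rewrite -(bigA_distr_bigA F) (bigD1 i)//= (bigD1 j) /=; last by rewrite eq_sym.
rewrite !big_bool /F eqxx eq_sym (negbTE ij) eqxx /= mul1n mul1n.
rewrite (eq_bigr (fun=> 2%N)) => [|l /andP[/negbTE li /negbTE lj]]; last first.
  by rewrite big_bool li lj.
rewrite prod_nat_const -[4%N]/(2 ^ 2)%N -expnD; congr (2 ^ _)%N.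
rewrite -[RHS]card_ord -(cardC (pred2 i j)) card2 ij; congr (2 + _)%N.
by apply: eq_card => l; rewrite !inE negb_or.
Qed.

(** * The Borel sigma-algebra of matrices and resampling of a column *)

Section MatrixSigmaAlgebra.
Variables (R : realType) (m n : nat).

(** The generators are products over columns rather than over entries because independence is a
    statement about Borel sets of columns; they are stable under intersection, so a probability is
    determined by its values on them. *)
Definition column_rectangles : set (set 'M[R]_(m, n)) :=
  [set S | exists2 B : 'I_n -> set 'cV[R]_m, (forall i, borel_cV (B i)) &
     S = [set M | forall i, B i (col i M)]].

Definition mx_measurableType := g_sigma_algebraType column_rectangles.

Lemma borel_cVT : @borel_cV R m setT.
Proof. by rewrite -setC0; apply: sigma_algebraC; apply: sigma_algebra0. Qed.

Lemma borel_cV_coord (j : 'I_m) (Y : set R) :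
  measurable Y -> borel_cV [set v : 'cV[R]_m | Y (v j 0)].
Proof.
move=> mY; apply: sub_sigma_algebra; rewrite -bigcup_seq/=; exists j.
  by rewrite /= mem_index_enum.
by exists Y => //; rewrite setTI.
Qed.

Lemma borel_cVI (A B : set 'cV[R]_m) :
  borel_cV A -> borel_cV B -> borel_cV (A `&` B).
Proof.
by move=> bA bB; apply: (@measurableI _ (g_sigma_algebraType _) A B bA bB).
Qed.

Lemma measurable_entry (j : 'I_m) (i : 'I_n) :
  measurable_fun setT (fun M : mx_measurableType => M j i).
Proof.
move=> _ Y mY; rewrite setTI; apply: sub_sigma_algebra.
exists (fun l => if l == i then [set v | Y (v j 0)] else setT) => [l|].
  by case: ifP => _; [exact: borel_cV_coord|exact: borel_cVT].
apply/seteqP; split => M /=.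
  by move=> YM l; case: eqP => [->|]//=; rewrite mxE.
by move=> /(_ i); rewrite eqxx /= mxE.
Qed.

Lemma column_rectanglesI : setI_closed column_rectangles.
Proof.
move=> _ _ [B bB ->] [C bC ->]; exists (fun i => B i `&` C i).
  by move=> i; exact: borel_cVI.
apply/seteqP; split => M /=; first by move=> [BM CM] i; split.
by move=> BCM; split=> i; have [] := BCM i.
Qed.

Lemma column_rectanglesT : column_rectangles setT.
Proof.
by exists (fun=> setT) => [i|]; [exact: borel_cVT|apply/seteqP; split].
Qed.

Lemma measurable_col_preimage d (Omega : measurableType d)
    (A : Omega -> 'M[R]_(m, n)) (i : 'I_n) (B : set 'cV[R]_m) :
  random_matrix A -> borel_cV B -> measurable [set w | B (col i (A w))].
Proof.
move=> mA bB.
pose G := \big[setU/set0]_(j < m) preimage_set_system setT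
  (fun v : 'cV[R]_m => v j 0) measurable.
have : @measurable_fun _ _ Omega (g_sigma_algebraType G) setT
    (fun w => col i (A w)).
  apply: (@measurability _ _ _ (g_sigma_algebraType G) _ _ G erefl).
  move=> _ [/= C bC <-].
  move: bC; rewrite /G -bigcup_seq => -[j _ [Y mY <-]].
  rewrite !setTI; have := mA j i measurableT Y mY; rewrite setTI.
  by congr measurable; apply/seteqP; split => w /=; rewrite mxE.
by move=> /(_ measurableT B bB); rewrite setTI.
Qed.

Lemma measurable_random_matrix d (Omega : measurableType d)
    (A : Omega -> 'M[R]_(m, n)) : random_matrix A ->
  @measurable_fun _ _ Omega mx_measurableType setT A.
Proof.
move=> rA.
apply: (@measurability _ _ _ mx_measurableType _ _ column_rectangles erefl).
move=> _ [_ [B bB ->] <-]; rewrite setTI.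
rewrite [X in measurable X](_ : _ =
    \bigcap_(i in [set: 'I_n]) [set w | B i (col i (A w))]); last first.
  by apply/seteqP; split => w /= h i; [move=> _; exact: h|exact: (h i I)].
apply: fin_bigcap_measurable => // i _.
exact: measurable_col_preimage.
Qed.

End MatrixSigmaAlgebra.

Section Resampling.
Variables (R : realType) (m n : nat) (d : measure_display).
Variables (Omega : measurableType d) (P : probability Omega R).
Variable A : Omega -> 'M[R]_(m, n).
Hypothesis mA : random_matrix A.
Hypothesis indA : independent_vectors P (fun i w => col i (A w)).

Definition replace_col (i : 'I_n) (M N : 'M[R]_(m, n)) : 'M[R]_(m, n) :=
  \matrix_(j, l) if l == i then N j l else M j l.

Lemma col_replace_col i M N : col i (replace_col i M N) = col i N.
Proof. by apply/colP => j; rewrite !mxE eqxx. Qed.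

Lemma col_replace_col_neq i l M N : l != i ->
  col l (replace_col i M N) = col l M.
Proof. by move=> /negbTE li; apply/colP => j; rewrite !mxE li. Qed.

(** Column [i] is read from an independent copy of the sample space. Fubini on the product then
    integrates column [i] with all others frozen. *)
Definition resampled i (z : Omega * Omega) : 'M[R]_(m, n) :=
  replace_col i (A z.1) (A z.2).

Lemma measurable_resampled i : random_matrix (resampled i).
Proof.
move=> j l; rewrite /resampled /replace_col.
have [->|li] := eqVneq l i.
  rewrite (_ : (fun z => _) = (fun w => A w j i) \o snd); last first.
    by apply/funext => z /=; rewrite mxE eqxx.
  exact: measurableT_comp.
rewrite (_ : (fun z => _) = (fun w => A w j l) \o fst); last first.
  by apply/funext => z /=; rewrite mxE (negbTE li).
exact: measurableT_comp.
Qed.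

Let prob_rectangle (J : {set 'I_n}) (B : 'I_n -> set 'cV[R]_m) :
  (forall i, borel_cV (B i)) ->
  P [set w | forall i, i \in J -> B i (col i (A w))] =
  (\prod_(i in J) P [set w | B i (col i (A w))])%E.
Proof.
move=> bB; rewrite -(@indA J B) => [|i _]; last exact: bB.
by congr (P _); apply/seteqP; split => w /=.
Qed.

(** On a column rectangle independence splits off the factor of column [i], and so does the product
    measure; uniqueness of measures on a generating pi-system does the rest. *)
Lemma resampled_law i (S : set (mx_measurableType R m n)) : measurable S ->
  P (A @^-1` S) = (P \x P)%E (resampled i @^-1` S).
Proof.
move=> mS.
have mA' := measurable_random_matrix mA.
have mR' := measurable_random_matrix (measurable_resampled i).
have rectE B : (forall i, borel_cV (B i)) ->
    P (A @^-1` [set M | forall l, B l (col l M)]) =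
    (P \x P)%E (resampled i @^-1` [set M | forall l, B l (col l M)]).
  move=> bB.
  have -> : A @^-1` [set M | forall i, B i (col i M)] =
      [set w | forall i, i \in [set: 'I_n]%SET -> B i (col i (A w))].
    by apply/seteqP; split => w /= h l; [move=> _|]; apply: h; rewrite ?inE.
  rewrite prob_rectangle//.
  have -> : resampled i @^-1` [set M | forall i, B i (col i M)] =
      [set w | forall l, l \in [set~ i]%SET -> B l (col l (A w))] `*`
      [set w | B i (col i (A w))].
    apply/seteqP; split => -[w1 w2] /=.
      move=> h; split; last by have := h i; rewrite col_replace_col.
      move=> l; rewrite !inE => li.
      by have := h l; rewrite col_replace_col_neq.
    move=> [h1 h2] l; have [->|li] := eqVneq l i; first by rewrite col_replace_col.
    by rewrite col_replace_col_neq//; apply: h1; rewrite !inE.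
  rewrite product_measure1E; last 2 first.
  + rewrite (_ : [set w | _] =
        \bigcap_(l in [set l | l != i]) [set w | B l (col l (A w))]); last first.
      by apply/seteqP; split => w /= h l li; apply: h; move: li; rewrite !inE.
    apply: fin_bigcap_measurable => [|l _]; last exact: measurable_col_preimage.
    by apply: (@sub_finite_set _ _ [set: 'I_n]).
  + exact: measurable_col_preimage.
  rewrite [X in _ = (X * _)%E](prob_rectangle [set~ i]%SET bB).
  rewrite (bigD1 i) ?inE//= muleC; congr (_ * _)%E.
  by apply: eq_bigl => l; rewrite !inE.
apply: (@measure_unique _ R (mx_measurableType R m n)
  (@column_rectangles R m n) (fun=> setT) erefl (@column_rectanglesI R m n)
  (fun=> @column_rectanglesT R m n) _
  (pushforward P (A : Omega -> mx_measurableType R m n))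
  (pushforward (P \x P)%E (resampled i : _ -> mx_measurableType R m n))) => //.
- by rewrite bigcup_const.
- by move=> _ [B bB ->]; exact: rectE.
- by move=> _; rewrite /= /pushforward preimage_setT probability_setT ltry.
Qed.

End Resampling.

(** * Expectations of functions of the matrix *)

Section DotProduct.
Variables (R : realType) (n : nat).
Implicit Types x y z : 'cV[R]_n.

Lemma dotvC x y : dotv x y = dotv y x.
Proof. by apply: eq_bigr => i _; rewrite mulrC. Qed.

Lemma dotvDl x y z : dotv (x + y) z = dotv x z + dotv y z.
Proof.
by rewrite /dotv -big_split; apply: eq_bigr => i _; rewrite mxE mulrDl.
Qed.

Lemma dotvZl (a : R) x y : dotv (a *: x) y = a * dotv x y.
Proof.
by rewrite /dotv mulr_sumr; apply: eq_bigr => i _; rewrite mxE mulrA.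
Qed.

Lemma dotvDr x y z : dotv x (y + z) = dotv x y + dotv x z.
Proof. by rewrite dotvC dotvDl !(dotvC x). Qed.

Lemma dotvZr (a : R) x y : dotv x (a *: y) = a * dotv x y.
Proof. by rewrite dotvC dotvZl dotvC. Qed.

Lemma dotvNl x y : dotv (- x) y = - dotv x y.
Proof. by rewrite -scaleN1r dotvZl mulN1r. Qed.

Lemma dotvNr x y : dotv x (- y) = - dotv x y.
Proof. by rewrite dotvC dotvNl dotvC. Qed.

Lemma dotv0l x : dotv 0 x = 0.
Proof. by rewrite -(scale0r x) dotvZl mul0r. Qed.

Lemma dotvv_ge0 x : 0 <= dotv x x.
Proof. by apply: sumr_ge0 => i _; rewrite -expr2 sqr_ge0. Qed.

Lemma dotvv_eq0 x : dotv x x = 0 -> x = 0.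
Proof.
move=> /eqP; rewrite psumr_eq0 => [/allP h|i _]; last by rewrite -expr2 sqr_ge0.
apply/colP => i; apply/eqP; rewrite mxE -sqrf_eq0 expr2.
by have := h i (mem_index_enum i).
Qed.

Lemma dotv_delta x i : dotv x (delta_mx i 0) = x i 0.
Proof.
rewrite /dotv (bigD1 i)//= big1 => [|j /negbTE ji].
  by rewrite mxE !eqxx mulr1 addr0.
by rewrite mxE ji andFb mulr0.
Qed.

Lemma sqr_entry_le x i : x i 0 ^+ 2 <= dotv x x.
Proof.
rewrite /dotv (bigD1 i)//= -expr2 lerDl.
by apply: sumr_ge0 => j _; rewrite -expr2 sqr_ge0.
Qed.

Lemma sqr_l2norm x : l2norm x ^+ 2 = dotv x x.
Proof. by rewrite sqr_sqrtr// dotvv_ge0. Qed.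

Lemma l2norm_ge0 x : 0 <= l2norm x.
Proof. exact: sqrtr_ge0. Qed.

End DotProduct.

Section TameFunctions.
Variables (R : realType) (m n : nat).
Implicit Types (f g : 'M[R]_(m, n) -> R) (M : 'M[R]_(m, n)).

Definition unit_cols M := forall i, l2norm (col i M) = 1.

(** Boundedness is asked only on matrices with unit columns, which carry full probability.
    Polynomials in the entries are then tame, and integrability becomes automatic. *)
Definition tame f :=
  measurable_fun setT (f : mx_measurableType R m n -> R) /\
  exists B, forall M, unit_cols M -> `|f M| <= B.

Lemma tame_cst (c : R) : tame (fun=> c).
Proof. by split; [exact: measurable_cst|exists `|c|]. Qed.

Lemma tame_entry j i : tame (fun M => M j i).
Proof.
split; first exact: measurable_entry.
exists 1 => M uM; rewrite -(expr_le1 (n := 2))// real_normK ?num_real//.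
have := sqr_entry_le (col i M) j; rewrite mxE => /le_trans; apply.
by rewrite -sqr_l2norm uM expr1n.
Qed.

Lemma tameD f g : tame f -> tame g -> tame (fun M => f M + g M).
Proof.
move=> [mf [B fB]] [mg [C gC]]; split; first exact: measurable_funD.
by exists (B + C) => M uM; rewrite (le_trans (ler_normD _ _))// lerD ?fB ?gC.
Qed.

Lemma tameM f g : tame f -> tame g -> tame (fun M => f M * g M).
Proof.
move=> [mf [B fB]] [mg [C gC]]; split; first exact: measurable_funM.
by exists (B * C) => M uM; rewrite normrM ler_pM ?fB ?gC.
Qed.

Lemma tame_sum (I : Type) (s : seq I) (p : pred I) (F : I -> 'M[R]_(m, n) -> R) :
  (forall i, tame (F i)) -> tame (fun M => \sum_(i <- s | p i) F i M).
Proof.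
move=> tF; elim: s => [|i s IH].
  under eq_fun do rewrite big_nil; exact: tame_cst.
under eq_fun do rewrite big_cons.
by case: (p i) => //; exact: tameD.
Qed.

Lemma tameX f k : tame f -> tame (fun M => f M ^+ k).
Proof.
move=> tf; elim: k => [|k IH]; first exact: tame_cst.
by under eq_fun do rewrite exprS; exact: tameM.
Qed.

Lemma tame_dotv (F G : 'M[R]_(m, n) -> 'cV[R]_m) :
  (forall j, tame (fun M => F M j 0)) -> (forall j, tame (fun M => G M j 0)) ->
  tame (fun M => dotv (F M) (G M)).
Proof. by move=> tF tG; apply: tame_sum => j; exact: tameM. Qed.

Lemma tame_mulmx (u : 'cV[R]_n) j : tame (fun M => (M *m u) j 0).
Proof.
under eq_fun do rewrite mxE.
by apply: tame_sum => i; apply: tameM; [exact: tame_entry|exact: tame_cst].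
Qed.

Lemma tame_col i j : tame (fun M => col i M j 0).
Proof. by under eq_fun do rewrite mxE; exact: tame_entry. Qed.

End TameFunctions.

Ltac tame := repeat (first
  [ exact: tame_cst | apply: tame_dotv => ? | exact: tame_mulmx | exact: tame_col
  | apply: tameX | apply: tameD | apply: tameM | apply: tame_sum => ? ]).

Section Expectation.
Variables (R : realType) (m n : nat) (d : measure_display).
Variables (Omega : measurableType d) (P : probability Omega R).
Variable A : Omega -> 'M[R]_(m, n).
Hypothesis mA : random_matrix A.
Hypothesis indA : independent_vectors P (fun i w => col i (A w)).
Hypothesis normA : forall i, {ae P, forall w, l2norm (col i (A w)) = 1}.
Implicit Types f g : 'M[R]_(m, n) -> R.

Definition Ex f : R := \int[P]_w f (A w).

Lemma ae_unit_cols : {ae P, forall w, unit_cols (A w)}.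
Proof. exact: filter_forall. Qed.

Lemma tame_measurable f : tame f -> measurable_fun setT (f \o A).
Proof.
move=> [mf _]; exact: (measurableT_comp mf (measurable_random_matrix mA)).
Qed.

Lemma tame_integrable f : tame f -> P.-integrable setT (EFin \o (f \o A)).
Proof.
move=> tf; have mf := tame_measurable tf.
apply/integrableP; split; first exact/measurable_EFinP.
have [_ [B fB]] := tf.
apply: (@le_lt_trans _ _ (`|B|%:E * P setT)%E).
  apply: integral_le_bound => //.
  - exact/measurable_EFinP.
  - by apply: filterS ae_unit_cols => w uA _; rewrite lee_fin /= (le_trans (fB _ uA)) ?ler_norm.
by rewrite probability_setT mule1 ltry.
Qed.

Lemma EFin_Ex f : tame f -> (Ex f)%:E = (\int[P]_w (f (A w))%:E)%E.
Proof. by move=> tf; rewrite fineK//; apply: integrable_fin_num => //; exact: tame_integrable. Qed.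

Lemma ExD f g : tame f -> tame g -> Ex (fun M => f M + g M) = Ex f + Ex g.
Proof. by move=> /tame_integrable tf /tame_integrable tg; exact: RintegralD. Qed.

Lemma ExZ (c : R) f : tame f -> Ex (fun M => c * f M) = c * Ex f.
Proof. by move=> /tame_integrable tf; exact: RintegralZl. Qed.

Lemma Ex_cst (c : R) : Ex (fun=> c) = c.
Proof.
rewrite /Ex Rintegral_cst// -[RHS]mulr1; congr (_ * _).
exact: (congr1 fine (probability_setT P)).
Qed.

Lemma Ex_sum (I : Type) (s : seq I) (p : pred I) (F : I -> 'M[R]_(m, n) -> R) :
  (forall i, tame (F i)) ->
  Ex (fun M => \sum_(i <- s | p i) F i M) = \sum_(i <- s | p i) Ex (F i).
Proof.
move=> tF; elim: s => [|i s IH].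
  by rewrite big_nil -[RHS](Ex_cst 0); congr Ex; apply/funext => M; rewrite big_nil.
rewrite big_cons; transitivity (Ex (fun M => if p i then F i M +
    \sum_(i <- s | p i) F i M else \sum_(i <- s | p i) F i M)).
  by congr Ex; apply/funext => M; rewrite big_cons.
by case: (p i) => //; rewrite ExD ?IH//; exact: tame_sum.
Qed.

Lemma Ex_le f g : tame f -> tame g ->
  (forall M, unit_cols M -> f M <= g M) -> Ex f <= Ex g.
Proof.
move=> tf tg fg; have mf := tame_measurable tf; have mg := tame_measurable tg.
(* The inequality is known only on unit columns. The minimum equals [f] almost surely and lies below
   [g] everywhere. *)
pose h w := Order.min (f (A w)) (g (A w)).
have mh : measurable_fun setT h by exact: measurable_minr.
have -> : Ex f = \int[P]_w h w.
  congr fine; apply: ae_eq_integral => //; [exact/measurable_EFinP..|].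
  by apply: filterS ae_unit_cols => w uA _; rewrite /h min_l// fg.
apply: le_Rintegral => //.
- have fh : ae_eq P setT (EFin \o (f \o A)) (EFin \o h).
    by apply: filterS ae_unit_cols => w uA _; rewrite /h /= min_l// fg.
  apply/integrableP; split; first exact/measurable_EFinP.
  have /integrableP[_] := tame_integrable tf; apply: le_lt_trans.
  rewrite le_eqVlt; apply/orP; left; apply/eqP; apply: ae_eq_integral => //.
  + by apply: measurableT_comp => //; exact/measurable_EFinP.
  + by apply: measurableT_comp => //; exact/measurable_EFinP.
  + by apply: filterS fh => w fw Dw; move: (fw Dw) => /= [<-].
- exact: tame_integrable.
- by move=> w _; rewrite /h ge_min lexx orbT.
Qed.

Lemma Ex_ge0 f : (forall M, 0 <= f M) -> 0 <= Ex f.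
Proof. by move=> f0; apply: Rintegral_ge0 => w _. Qed.

(* Conditionally on the other columns, column [i] is averaged with its own law. *)
Lemma Ex_le_average_col (i : 'I_n) f g : tame f -> tame g ->
  (forall M, (\int[P]_w (f (replace_col i M (A w)))%:E <= (g M)%:E)%E) ->
  Ex f <= Ex g.
Proof.
move=> tf tg fg; rewrite -lee_fin !EFin_Ex//.
pose res := resampled A i.
have mA' := measurable_random_matrix mA.
have mf : measurable_fun setT (EFin \o f : mx_measurableType R m n -> \bar R).
  by case: tf => mf _; exact/measurable_EFinP.
have mres := measurable_random_matrix (measurable_resampled mA i).
have lawE (h : mx_measurableType R m n -> \bar R) :
    (\int[pushforward P (A : Omega -> mx_measurableType R m n)]_x h x =
     \int[pushforward (P \x P) (res : Omega * Omega -> mx_measurableType R m n)]_x h x)%E.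
  apply: eq_measure_integral => S mS _.
  exact: (resampled_law mA indA i mS).
(* Integrability over the product, which Fubini requires, is transported from [A] by equality of the
   laws. *)
have intres : (P \x P)%E.-integrable setT ((EFin \o f) \o res).
  apply/integrableP; split; first exact: (measurableT_comp mf mres).
  have /integrableP[_] := tame_integrable tf; apply: le_lt_trans.
  rewrite -(@ge0_integral_pushforward _ _ _ (mx_measurableType R m n) _ res mres
    (P \x P)%E setT (fun M => `|(f M)%:E|)%E)//; last first.
    exact: measurableT_comp mf.
  rewrite -lawE ge0_integral_pushforward//; exact: measurableT_comp mf.
have -> : (\int[P]_w (f (A w))%:E = \int[P]_x \int[P]_y (f (res (x, y)))%:E)%E.
  rewrite [RHS](integral12_prod_meas1 intres).
  rewrite -(@integral_pushforward _ _ _ (mx_measurableType R m n) R res mres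
     (P \x P)%E setT (EFin \o f))//.
  by rewrite -lawE integral_pushforward//; exact: tame_integrable.
apply: le_integral => //.
- exact: (integrable_fubini_F intres).
- exact: tame_integrable.
- by move=> x _; exact: (fg (A x)).
Qed.

End Expectation.

(** * Moments of the decoupled Gram form *)

Section Peeling.
Variables (R : realType) (m n : nat) (d : measure_display).
Variables (Omega : measurableType d) (P : probability Omega R).
Variable A : Omega -> 'M[R]_(m, n).
Hypothesis mA : random_matrix A.
Hypothesis indA : independent_vectors P (fun i w => col i (A w)).
Hypothesis meanA : forall i j, ('E_P[fun w => A w j i] = 0)%E.
Hypothesis normA : forall i, {ae P, forall w, l2norm (col i (A w)) = 1}.
Variable c : nat -> R.
Hypothesis momA : forall l i v,
  (\int[P]_w (dotv (col i (A w)) v ^+ l.*2)%:E <= (c l * dotv v v ^+ l)%:E)%E.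
Let E := Ex P A.

Lemma mulmx_replace_col i M N (v : 'cV[R]_n) : v i 0 = 0 ->
  replace_col i M N *m v = M *m v :> 'cV[R]_m.
Proof.
move=> vi; apply/colP => j; rewrite !mxE; apply: eq_bigr => l _; rewrite !mxE.
by case: eqP => [->|//]; rewrite vi !mulr0.
Qed.

Lemma integral_dotv_col i (v : 'cV[R]_m) :
  (\int[P]_w (dotv (col i (A w)) v)%:E = 0)%E.
Proof.
have tc := @tame_col R m n i.
have t j : tame (fun M : 'M[R]_(m, n) => v j 0 * col i M j 0).
  by apply: tameM; [exact: tame_cst|exact: tc].
have -> : (\int[P]_w (dotv (col i (A w)) v)%:E)%E =
    (E (fun M => \sum_j v j 0 * col i M j 0))%:E.
  rewrite EFin_Ex//; last exact: tame_sum.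
  by apply: eq_integral => w _; congr EFin; apply: eq_bigr => j _; rewrite mulrC.
rewrite /E Ex_sum// big1// => j _; rewrite ExZ//.
suff -> : Ex P A (fun M => col i M j 0) = 0 by rewrite mulr0.
apply/EFin_inj; rewrite EFin_Ex//; have := meanA i j; rewrite unlock => e; rewrite -[RHS]e.
by apply: eq_integral => w _; rewrite mxE.
Qed.

(** Since [v i 0 = 0], neither [M *m v] nor [f] sees column [i]; with the other columns fixed, the
    remaining factor is a linear form in a mean-zero vector. *)
Lemma Ex_linear_le0 i f (v : 'cV[R]_n) : v i 0 = 0 -> tame f ->
  (forall M N, f (replace_col i M N) = f M) ->
  E (fun M => dotv (col i M) (M *m v) * f M) <= 0.
Proof.
move=> vi tf fi; rewrite -[leRHS](Ex_cst P A 0).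
apply: (@Ex_le_average_col _ _ _ _ _ _ _ mA indA normA i).
- by tame.
- exact: tame_cst.
move=> M; under eq_integral do
  rewrite col_replace_col mulmx_replace_col// fi mulrC EFinM.
rewrite integralZl//; first by rewrite integral_dotv_col mule0.
apply: (tame_integrable mA normA (f := fun N => dotv (col i N) (M *m v))).
by apply: tame_dotv => j; [exact: tame_col|exact: tame_cst].
Qed.

(** With the other columns fixed, [M *m v] is a deterministic direction to which [momA] applies. The
    power of |Mv| that appears is why later bounds carry an extra weight. *)
Lemma Ex_moment_le i l f (v : 'cV[R]_n) : v i 0 = 0 -> tame f ->
  (forall M, 0 <= f M) -> (forall M N, f (replace_col i M N) = f M) ->
  E (fun M => dotv (col i M) (M *m v) ^+ l.*2 * f M) <=
  c l * E (fun M => dotv (M *m v) (M *m v) ^+ l * f M).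
Proof.
move=> vi tf f0 fi.
have tw : tame (fun M : 'M[R]_(m, n) => dotv (M *m v) (M *m v) ^+ l * f M).
  by tame.
rewrite /E -ExZ//; apply: (@Ex_le_average_col _ _ _ _ _ _ _ mA indA normA i).
- by tame.
- by apply: tameM => //; exact: tame_cst.
move=> M; under eq_integral do
  rewrite col_replace_col mulmx_replace_col// fi mulrC EFinM.
rewrite integralZl//; last first.
  apply: (tame_integrable mA normA (f := fun N => dotv (col i N) (M *m v) ^+ l.*2)).
  by apply/tameX/tame_dotv => j; [exact: tame_col|exact: tame_cst].
rewrite mulrA [leRHS]EFinM muleC lee_wpmul2r ?lee_fin//.
Qed.

(** Induction on the size of the support of [u], one column being integrated out per step. Peeling
    releases a factor |Mv|^(2l) and lowers [k] to [k - l], so the induction needs the extra exponent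
    [r]. The disjoint supports keep [M *m v] free of the peeled column. *)
Lemma decoupled_moment_le (k0 : nat) (theta : R) : 0 <= theta ->
  (forall l, (l <= k0)%N -> 3 ^+ l * c l <= (l.*2 ^_ l)%:R * theta ^+ l) ->
  forall (u v : 'cV[R]_n) k r, (k <= k0)%N ->
  (forall i, u i 0 = 0 \/ v i 0 = 0) ->
  E (fun M => dotv (M *m u) (M *m v) ^+ k.*2 * dotv (M *m v) (M *m v) ^+ r) <=
  (k.*2 ^_ k)%:R * (theta * dotv u u) ^+ k *
  E (fun M => dotv (M *m v) (M *m v) ^+ (k + r)).
Proof.
move=> theta0 Hc u v k r kk0 uv.
have [p] : {p | #|[pred i | u i 0 != 0]| = p} by exists #|[pred i | u i 0 != 0]|.
elim: p u k r kk0 uv => [|p IH] u k r kk0 uv.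
  move=> /eqP/pred0P u0; have -> : u = 0.
    by apply/colP => i; have := u0 i; rewrite /= mxE => /negbT; rewrite negbK => /eqP.
  under eq_fun do rewrite mulmx0 dotv0l.
  case: k kk0 => [|k] _.
    rewrite !expr0 ffactn0 mulr1 mul1r.
    by under eq_fun do rewrite mul1r.
  under eq_fun do rewrite doubleS exprS !mul0r.
  rewrite /E Ex_cst mulr_ge0//; last by apply: Ex_ge0 => M; rewrite exprn_ge0// dotvv_ge0.
  by rewrite mulr_ge0// exprn_ge0// mulr_ge0// dotvv_ge0.
move=> cardu; pose D := [pred i | u i 0 != 0].
have /card_gt0P[i ui] : (0 < #|D|)%N by rewrite cardu.
have {}ui : u i 0 != 0 by [].
have vi : v i 0 = 0 by case: (uv i) ui => // ->; rewrite eqxx.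
pose u' : 'cV[R]_n := u - u i 0 *: delta_mx i 0.
have u'i : u' i 0 = 0 by rewrite !mxE !eqxx mulr1 subrr.
have u'j j : j != i -> u' j 0 = u j 0.
  by move=> /negbTE ji; rewrite !mxE ji andFb mulr0 subr0.
have uu : dotv u u = u i 0 ^+ 2 + dotv u' u'.
  rewrite {1}/dotv (bigD1 i)//= -expr2; congr (_ + _).
  rewrite [RHS](bigD1 i)//= u'i mul0r add0r; apply: eq_bigr => j ji.
  by rewrite u'j.
have u'v j : u' j 0 = 0 \/ v j 0 = 0.
  have [->|ji] := eqVneq j i; first by left.
  by rewrite u'j.
have cardu' : #|[pred i | u' i 0 != 0]| = p.
  have := cardD1 i [pred i | u i 0 != 0]; rewrite cardu inE ui => -[->].
  apply: eq_card => j; rewrite !inE.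
  by have [->|ji] := eqVneq j i; [rewrite u'i eqxx|rewrite u'j].
pose X (M : 'M[R]_(m, n)) : R := dotv (col i M) (M *m v).
pose S (M : 'M[R]_(m, n)) : R := dotv (M *m u') (M *m v).
pose W (M : 'M[R]_(m, n)) : R := dotv (M *m v) (M *m v).
have tX : tame X by rewrite /X; tame.
have tS : tame S by rewrite /S; tame.
have tW : tame W by rewrite /W; tame.
have W0 M : 0 <= W M by exact: dotvv_ge0.
have SE M : dotv (M *m u) (M *m v) = S M + u i 0 * X M.
  rewrite -dotvZl -dotvDl; congr (dotv _ _).
  rewrite /u' mulmxBr -scalemxAr colE.
  by rewrite subrK.
have Srep M N : S (replace_col i M N) = S M by rewrite /S !mulmx_replace_col.
have Wrep M N : W (replace_col i M N) = W M by rewrite /W !mulmx_replace_col.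
pose lin M : R := X M * ((k.*2%:R * u i 0) * (S M ^+ k.*2.-1 * W M ^+ r)).
pose coef l : R := 'C(k.*2, l.*2)%:R * 3 ^+ l * u i 0 ^+ l.*2.
pose quad l M : R := coef l * (X M ^+ l.*2 * (S M ^+ (k - l).*2 * W M ^+ r)).
have coef0 l : 0 <= coef l.
  by rewrite /coef !mulr_ge0// ?exprn_even_doublege0 ?exprn_ge0.
have tquad l : tame (quad l) by rewrite /quad; tame.
have tlin : tame lin by rewrite /lin; tame.
apply: (@le_trans _ _ (E (fun M => lin M + \sum_(l < k.+1) quad l M))).
  apply: Ex_le => //; [by rewrite -/W; tame|by apply: tameD => //; exact: tame_sum|].
  move=> M _; rewrite SE -/(W M).
  have := ler_wpM2r (exprn_ge0 r (W0 M)) (exprD_even_le k (S M) (u i 0 * X M)).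
  move=> /le_trans; apply; rewrite mulrDl le_eqVlt; apply/orP; left; apply/eqP.
  congr (_ + _); first by rewrite /lin; ring.
  rewrite mulr_suml; apply: eq_bigr => l _; rewrite /quad /coef exprMn; ring.
rewrite /E ExD//; last exact: tame_sum.
rewrite Ex_sum//.
have lin0 : Ex P A lin <= 0.
  apply: (@Ex_linear_le0 i (fun M => (k.*2%:R * u i 0) * (S M ^+ k.*2.-1 * W M ^+ r)) v) => //.
    by tame.
  by move=> M N; rewrite Srep Wrep.
apply: (@le_trans _ _ (\sum_(l < k.+1) Ex P A (quad l))); first by rewrite gerDr.
have EW0 q : 0 <= E (fun M => W M ^+ q) by apply: Ex_ge0 => M; rewrite exprn_ge0.
(* The target is expanded by the binomial theorem along |u|^2 = u_i^2 + |u'|^2, so it remains to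
   compare term by term. *)
apply: (@le_trans _ _ (\sum_(l < k.+1) ((k.*2 ^_ k)%:R *
    ((theta * dotv u' u') ^+ (k - l) * (theta * u i 0 ^+ 2) ^+ l *+ 'C(k, l)) *
    E (fun M => W M ^+ (k + r))))); last first.
  by rewrite -mulr_suml -mulr_sumr -exprDn uu mulrDr [X in X ^+ k]addrC.
apply: ler_sum => -[l /=]; rewrite ltnS => lk _.
rewrite /quad ExZ//; last by tame.
have h1 : Ex P A (fun M => X M ^+ l.*2 * (S M ^+ (k - l).*2 * W M ^+ r)) <=
    c l * E (fun M => S M ^+ (k - l).*2 * W M ^+ (l + r)).
  apply: le_trans (@Ex_moment_le i l (fun M => S M ^+ (k - l).*2 * W M ^+ r) v vi _ _ _) _ => //.
  - by tame.
  - by move=> M; rewrite mulr_ge0// ?exprn_even_doublege0 ?exprn_ge0.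
  - by move=> M N; rewrite Srep Wrep.
  rewrite le_eqVlt; apply/orP; left; apply/eqP; congr (_ * Ex P A _).
  by apply/funext => M; rewrite exprD /W; ring.
(* The released power of |Mv| moves into [r], and [(k - l) + (l + r)] is again [k + r]. *)
have h2 := IH u' (k - l)%N (l + r)%N (leq_trans (leq_subr _ _) kk0) u'v cardu'.
rewrite addnA subnK// -/W -/S in h2.
have lk0 := leq_trans lk kk0.
have ES0 : 0 <= E (fun M => S M ^+ (k - l).*2 * W M ^+ (l + r)).
  by apply: Ex_ge0 => M; rewrite mulr_ge0 ?exprn_even_doublege0 ?exprn_ge0.
have b0 : 0 <= (theta * dotv u' u') ^+ (k - l).
  by rewrite exprn_ge0// mulr_ge0// dotvv_ge0.
apply: le_trans (ler_wpM2l (coef0 l) h1) _.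
have step : coef l * (c l * E (fun M => S M ^+ (k - l).*2 * W M ^+ (l + r))) <=
   'C(k.*2, l.*2)%:R * u i 0 ^+ l.*2 * ((l.*2 ^_ l)%:R * theta ^+ l) *
     E (fun M => S M ^+ (k - l).*2 * W M ^+ (l + r)).
  rewrite /coef mulrA ler_wpM2r//.
  have := ler_wpM2l (mulr_ge0 (ler0n R 'C(k.*2, l.*2)) (exprn_even_doublege0 (u i 0) l)) (Hc l lk0).
  by apply: le_trans; rewrite le_eqVlt; apply/orP; left; apply/eqP; ring.
apply: le_trans step _.
apply: le_trans (ler_wpM2l _ h2) _.
  by rewrite !mulr_ge0// ?exprn_even_doublege0 ?exprn_ge0.
have := bin_double_ffact lk => /(congr1 (fun x => x%:R : R)).
rewrite !natrM => e.
rewrite -[_ *+ 'C(k, l)]mulr_natr (expr_double (u i 0)) [(theta * u i 0 ^+ 2) ^+ l]exprMn.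
move: e; set b1 := (_ ^_ k)%:R; set b2 := 'C(k, l)%:R; set b3 := 'C(_, _)%:R.
set b4 := (_ ^_ l)%:R; set b5 := (_ ^_ (k - l))%:R => e.
set q := E _; set t := _ ^+ (k - l); set x := theta ^+ l; set y := _ ^+ l.
have -> : b1 * (t * (x * y) * b2) * q = b1 * b2 * (t * (x * y) * q) by ring.
by rewrite -e le_eqVlt; apply/orP; left; apply/eqP; ring.
Qed.

End Peeling.

(** * Decoupling *)

Section Decoupling.
Variables (R : realType) (m n : nat).
Implicit Types (u v : 'cV[R]_n) (M : 'M[R]_(m, n)) (I J : {set 'I_n}).

Definition restrict_entries I u : 'cV[R]_n :=
  \col_i (if i \in I then u i 0 else 0).

Lemma restrict_entriesI I J u :
  restrict_entries I (restrict_entries J u) = restrict_entries (I :&: J) u.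
Proof. by apply/colP => i; rewrite !mxE inE; case: (i \in I). Qed.

Lemma restrict_entriesT u : restrict_entries [set: 'I_n]%SET u = u.
Proof. by apply/colP => i; rewrite !mxE inE. Qed.

Lemma dotv_restrict_entries_le I u :
  dotv (restrict_entries I u) (restrict_entries I u) <= dotv u u.
Proof.
apply: ler_sum => i _; rewrite !mxE; case: ifP => // _.
by rewrite mul0r -expr2 sqr_ge0.
Qed.

(* For unit columns this is the off-diagonal part of the bilinear form of the Gram matrix. *)
Definition gram_excess M u v : R := dotv (M *m u) (M *m v) - dotv u v.

Lemma dotv_mulmx M u v : dotv (M *m u) (M *m v) =
  \sum_i \sum_j u i 0 * v j 0 * dotv (col i M) (col j M).
Proof.
rewrite /dotv; under eq_bigr do rewrite !mxE mulr_suml.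
rewrite exchange_big; apply: eq_bigr => i _ /=.
transitivity (\sum_(l < m) \sum_j M l i * u i 0 * (M l j * v j 0)).
  by apply: eq_bigr => l _; rewrite mulr_sumr.
rewrite exchange_big; apply: eq_bigr => j _ /=.
by rewrite mulr_sumr; apply: eq_bigr => l _; rewrite !mxE; ring.
Qed.

(** A pair of distinct indices is separated by a quarter of the sets, which the factor 4
    compensates. Diagonal pairs are never separated; for unit columns their contribution is
    [dotv u v], just what [gram_excess] subtracts. *)
Lemma gram_excess_decoupling M u v : unit_cols M ->
  gram_excess M u v = (\sum_(I : {set 'I_n})
     4 * dotv (M *m restrict_entries I u) (M *m restrict_entries (~: I) v)) /
     #|{: {set 'I_n}}|%:R.
Proof.
move=> uM; have N0 : #|{: {set 'I_n}}|%:R != 0 :> R.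
  by rewrite pnatr_eq0 -lt0n; apply/card_gt0P; exists finset.set0.
apply: (canRL (mulfK N0)).
have cardE : #|{: {set 'I_n}}| = (2 ^ n)%N by rewrite -cardsT -powersetT card_powerset cardsT card_ord.
rewrite cardE.
transitivity (\sum_i \sum_j u i 0 * v j 0 * dotv (col i M) (col j M) *
    (4 * \sum_(I : {set 'I_n}) (i \in I) * (j \notin I))%:R); last first.
  symmetry; under eq_bigr do rewrite dotv_mulmx.
  under eq_bigr do rewrite mulr_sumr.
  rewrite exchange_big; apply: eq_bigr => i _ /=.
  under eq_bigr do rewrite mulr_sumr.
  rewrite exchange_big; apply: eq_bigr => j _ /=.
  move: (dotv (col i M) (col j M)) => G.
  rewrite natrM natr_sum !mulr_sumr; apply: eq_bigr => I _.
  rewrite !mxE inE natrM.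
  by case: (i \in I); case: (j \in I) => /=; ring.
have dE : dotv u v = \sum_i u i 0 * v i 0 by [].
rewrite /gram_excess dotv_mulmx dE mulrBl [X in X - _]mulr_suml.
rewrite [X in _ - X]mulr_suml -sumrB.
apply: eq_bigr => i _; rewrite [X in X - _]mulr_suml (bigD1 i)//= [RHS](bigD1 i)//=.
have -> : dotv (col i M) (col i M) = 1 by rewrite -sqr_l2norm uM expr1n.
have -> : (\sum_(I : {set 'I_n}) (i \in I) * (i \notin I) = 0)%N.
  by rewrite big1// => I _; case: (i \in I).
rewrite muln0 mulr0 mulr1 add0r addrAC subrr add0r.
apply: eq_bigr => j ji; rewrite card_separating_sets// 1?eq_sym//.
Qed.

End Decoupling.

(** * Moments of the Gram excess and of |Mv| *)

Section GramMoments.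
Variables (R : realType) (m n : nat) (d : measure_display).
Variables (Omega : measurableType d) (P : probability Omega R).
Variable A : Omega -> 'M[R]_(m, n).
Hypothesis mA : random_matrix A.
Hypothesis normA : forall i, {ae P, forall w, l2norm (col i (A w)) = 1}.
Variables (k : nat) (b : R).
Hypothesis k0 : (0 < k)%N.
Hypothesis b0 : 0 < b.
Let E := Ex P A.
Let b0' : 0 <= b := ltW b0.
Hypothesis decoupled : forall u v : 'cV[R]_n,
  (forall i, u i 0 = 0 \/ v i 0 = 0) ->
  E (fun M => dotv (M *m u) (M *m v) ^+ k.*2) <=
  (b * dotv u u) ^+ k * E (fun M => dotv (M *m v) (M *m v) ^+ k).

Lemma tame_gram_excess (u v : 'cV[R]_n) : tame (fun M : 'M[R]_(m, n) => gram_excess M u v).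
Proof. by rewrite /gram_excess; tame. Qed.

(** Jensen over the sets I, then decoupling for each I. The moment left over is that of a
    restriction of [v] depending on I, so [N] must bound all of them; 16 is the square of the
    decoupling constant 4. *)
Lemma gram_excess_moment_le_of (u v : 'cV[R]_n) (N : R) :
  (forall I, E (fun M => dotv (M *m restrict_entries I v)
     (M *m restrict_entries I v) ^+ k) <= N) ->
  E (fun M => gram_excess M u v ^+ k.*2) <= (16 * b * dotv u u) ^+ k * N.
Proof.
move=> HN; have N0 : 0 <= N.
  by apply: le_trans (HN finset.set0); apply: Ex_ge0 => M; rewrite exprn_ge0// dotvv_ge0.
have card0 : (0 < #|{: {set 'I_n}}|)%N by apply/card_gt0P; exists finset.set0.
pose q I (M : 'M[R]_(m, n)) :=
  dotv (M *m restrict_entries I u) (M *m restrict_entries (~: I) v).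
have tq I : tame (fun M : 'M[R]_(m, n) => (4 * q I M) ^+ k.*2) by rewrite /q; tame.
apply: (@le_trans _ _ (E (fun M =>
    #|{: {set 'I_n}}|%:R^-1 * (\sum_(I : {set 'I_n}) (4 * q I M) ^+ k.*2)))).
  apply: Ex_le => //.
  - by apply: tameX; exact: tame_gram_excess.
  - by apply: tameM; [exact: tame_cst|exact: tame_sum].
  move=> M uM; rewrite gram_excess_decoupling// [leRHS]mulrC.
  exact: mean_exprn_double_le.
rewrite /E ExZ//; last exact: tame_sum.
rewrite Ex_sum// mulrC ler_pdivrMr ?ltr0n//.
rewrite mulr_natr -sumr_const.
apply: ler_sum => I _.
have -> : Ex P A (fun M => (4 * q I M) ^+ k.*2) =
    16 ^+ k * E (fun M => q I M ^+ k.*2).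
  rewrite /E -(ExZ mA normA); last by rewrite /q; tame.
  congr Ex; apply/funext => M; rewrite exprMn; congr (_ * _).
  by rewrite expr_double expr2 -natrM.
rewrite -(mulrA 16 b) [X in _ <= X * _]exprMn -mulrA ler_wpM2l ?exprn_ge0//.
have disj i : restrict_entries I u i 0 = 0 \/ restrict_entries (~: I) v i 0 = 0.
  by rewrite !mxE inE; case: (i \in I); [right|left].
apply: le_trans (decoupled disj) _.
apply: ler_pM.
- by rewrite exprn_ge0// mulr_ge0 ?dotvv_ge0.
- by apply: Ex_ge0 => M; rewrite exprn_ge0// dotvv_ge0.
- rewrite lerXn2r ?nnegrE ?mulr_ge0 ?dotvv_ge0//.
  by rewrite ler_pM2l// dotv_restrict_entries_le.
- exact: HN.
Qed.

(* Absorption: with [N] the largest moment over all restrictions of [v],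
   [gram_excess_moment_le_of] and AM-GM bound [N] by a constant plus [N / 2]. *)
Lemma norm_moment_restrict_le (v : 'cV[R]_n) (I : {set 'I_n}) : dotv v v <= 1 ->
  E (fun M => dotv (M *m restrict_entries I v) (M *m restrict_entries I v) ^+ k) <=
  4 ^+ k * (1 + (16 * b) ^+ k).
Proof.
move=> v1.
pose f J := E (fun M => dotv (M *m restrict_entries J v) (M *m restrict_entries J v) ^+ k).
(* The maximum over finitely many restrictions is attained at some J, and a restriction of a
   restriction is a restriction, so the bound for J feeds back into itself. *)
rewrite -/(f I); case: (@arg_maxP _ _ _ I xpredT f isT) => J _ HJ.
apply: le_trans (HJ I isT) _; set N := f J.
pose vJ := restrict_entries J v.
have vJ1 : dotv vJ vJ <= 1 by apply: le_trans v1; exact: dotv_restrict_entries_le.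
have a0 : 0 < (16 * b) ^+ k by rewrite exprn_gt0// mulr_gt0.
set a := (16 * b) ^+ k in a0 *.
have N0 : 0 <= N by apply: Ex_ge0 => M; rewrite exprn_ge0// dotvv_ge0.
have QN : E (fun M => gram_excess M vJ vJ ^+ k.*2) <= a * N.
  have := @gram_excess_moment_le_of vJ vJ N.
  move=> H; apply: le_trans (H _) _; last first.
    rewrite ler_wpM2r// /a lerXn2r ?nnegrE ?mulr_ge0 ?dotvv_ge0//.
    by rewrite ler_piMr// mulr_ge0.
  by move=> L; rewrite restrict_entriesI; exact: HJ.
have tQ : tame (fun M : 'M[R]_(m, n) => gram_excess M vJ vJ ^+ k.*2).
  by apply: tameX; exact: tame_gram_excess.
have : N <= (2 ^+ k + 2^-1 * (4 ^+ k * a)) + 2^-1 * a^-1 * (a * N).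
  apply: (@le_trans _ _ (E (fun M => (2 ^+ k + 2^-1 * (4 ^+ k * a)) +
      2^-1 * a^-1 * gram_excess M vJ vJ ^+ k.*2))).
    apply: Ex_le => //; [by tame|by do ?[apply: tameD|apply: tameM]; tame|].
    move=> M uM; set Q := gram_excess M vJ vJ.
    have YE : dotv (M *m vJ) (M *m vJ) = dotv vJ vJ + Q by rewrite /Q /gram_excess; ring.
    apply: (@le_trans _ _ (2 ^+ k * (1 + `|Q| ^+ k))).
      apply: (@le_trans _ _ ((1 + `|Q|) ^+ k)); last first.
        by rewrite (le_trans (exprnD_le _ _ _))// expr1n.
      rewrite lerXn2r ?nnegrE ?dotvv_ge0 ?addr_ge0// YE lerD//.
      exact: ler_norm.
    have -> : Q ^+ k.*2 = (`|Q| ^+ k) ^+ 2.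
      by rewrite -exprM mulnC exprM real_normK ?num_real// -expr_double.
    set q := `|Q| ^+ k; have -> : 4 ^+ k = (2 ^+ k) ^+ 2 :> R.
      by rewrite -exprM mulnC exprM expr2 -natrM.
    set t := 2 ^+ k.
    (* AM-GM for [t * q], weighted by [a] so that [a^-1] cancels the factor [a] in [QN] and exactly
       N / 2 remains. *)
    rewrite -subr_ge0 (_ : _ - _ = 2^-1 * a^-1 * (t * a - q) ^+ 2).
      apply: mulr_ge0; last exact: sqr_ge0.
      by rewrite mulr_ge0 ?invr_ge0 ?(ltW a0).
    by field; rewrite gt_eqF.
  rewrite /E (ExD mA normA); [|exact: tame_cst|by apply: tameM => //; exact: tame_cst].
  rewrite Ex_cst ExZ// lerD2l ler_pM2l// mulr_gt0// ?invr_gt0//.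
rewrite (_ : 2^-1 * a^-1 * (a * N) = 2^-1 * N); last by field; rewrite gt_eqF.
(* Solving for N doubles [2 ^+ k]; as [k] is positive, this still fits under [4 ^+ k]. *)
have h2 : 2 * 2 ^+ k <= 4 ^+ k :> R.
  have -> : 4 ^+ k = 2 ^+ k * 2 ^+ k :> R by rewrite -exprMn -natrM.
  rewrite ler_wpM2r ?exprn_ge0//; case: (k) k0 => // p _.
  by rewrite exprS ler_peMr// exprn_ege1// ler1n.
by move: (4 ^+ k) (2 ^+ k) h2 => x y h2 h; lra.
Qed.

Lemma norm_moment_le (v : 'cV[R]_n) : dotv v v <= 1 ->
  E (fun M => dotv (M *m v) (M *m v) ^+ k) <= 4 ^+ k * (1 + (16 * b) ^+ k).
Proof. by move=> /(@norm_moment_restrict_le v [set: 'I_n]%SET); rewrite restrict_entriesT. Qed.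

Lemma gram_excess_moment_le (u v : 'cV[R]_n) : dotv u u <= 1 -> dotv v v <= 1 ->
  E (fun M => gram_excess M u v ^+ k.*2) <=
  (16 * b) ^+ k * (4 ^+ k * (1 + (16 * b) ^+ k)).
Proof.
move=> u1 v1; apply: le_trans (gram_excess_moment_le_of u _) _.
  by move=> I; exact: norm_moment_restrict_le.
have h : 0 <= (16 * b) ^+ k by rewrite exprn_ge0// mulr_ge0.
rewrite ler_wpM2r ?mulr_ge0 ?exprn_ge0 ?addr_ge0//.
rewrite lerXn2r ?nnegrE ?mulr_ge0 ?dotvv_ge0//.
by rewrite ler_piMr// mulr_ge0.
Qed.

End GramMoments.

(** * Increments of the deviation *)

Section EuclideanNorm.
Variables (R : realType) (n : nat).
Implicit Types x y z : 'cV[R]_n.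

Lemma l2norm_eq0 x : l2norm x = 0 -> x = 0.
Proof. by move=> x0; apply: dotvv_eq0; rewrite -sqr_l2norm x0 expr0n. Qed.

Lemma l2norm0 : l2norm (0 : 'cV[R]_n) = 0.
Proof. by rewrite /l2norm dotv0l sqrtr0. Qed.

Lemma l2normZ (a : R) x : l2norm (a *: x) = `|a| * l2norm x.
Proof.
by rewrite /l2norm dotvZl dotvZr mulrA -expr2 sqrtrM ?sqr_ge0// sqrtr_sqr.
Qed.

Lemma l2normN x : l2norm (- x) = l2norm x.
Proof. by rewrite -scaleN1r l2normZ normrN1 mul1r. Qed.

Lemma dotv_le_l2norm x y : dotv x y <= l2norm x * l2norm y.
Proof.
have [x0|x0] := eqVneq (l2norm x) 0.
  by rewrite x0 (l2norm_eq0 x0) dotv0l mul0r.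
have [y0|y0] := eqVneq (l2norm y) 0.
  by rewrite y0 (l2norm_eq0 y0) dotvC dotv0l mulr0.
have p : 0 < l2norm x * l2norm y.
  by rewrite mulr_gt0// lt_neqAle eq_sym ?x0 ?y0 l2norm_ge0.
rewrite -(ler_pM2l p).
have := dotvv_ge0 (l2norm y *: x - l2norm x *: y).
rewrite dotvDl !dotvDr !dotvNl !dotvNr !dotvZl !dotvZr -!sqr_l2norm (dotvC y x).
by move: (dotv x y) (l2norm x) (l2norm y) => c a b; nra.
Qed.

Lemma ler_l2normD x y : l2norm (x + y) <= l2norm x + l2norm y.
Proof.
rewrite -(ler_pXn2r (n := 2))// ?nnegrE ?addr_ge0 ?l2norm_ge0//.
rewrite sqr_l2norm dotvDl !dotvDr (dotvC y x) sqrrD -!sqr_l2norm.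
by have := dotv_le_l2norm x y; lra.
Qed.

Lemma ler_dist_l2norm x y : `|l2norm x - l2norm y| <= l2norm (x - y).
Proof.
have h1 := ler_l2normD (x - y) y; have h2 := ler_l2normD (y - x) x.
rewrite subrK in h1; rewrite subrK -opprB l2normN in h2.
by rewrite ler_norml; apply/andP; split; lra.
Qed.

Lemma l2norm_unit_decomp (e x : 'cV[R]_n) : l2norm e = 1 ->
  exists2 xh, l2norm xh = 1 & x = l2norm x *: xh.
Proof.
move=> e1; have [x0|x0] := eqVneq (l2norm x) 0.
  by exists e => //; rewrite x0 scale0r; exact: l2norm_eq0.
exists ((l2norm x)^-1 *: x); last by rewrite scalerA divff// scale1r.
by rewrite l2normZ normfV ger0_norm ?l2norm_ge0// mulVf.
Qed.

(* Since [0^-1 = 0], the normalization of [0] is [0]. *)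
Lemma l2norm_normalize z (h := (l2norm z)^-1 *: z) :
  dotv h h <= 1 /\ z = l2norm z *: h.
Proof.
split; rewrite /h.
  rewrite -sqr_l2norm l2normZ normfV ger0_norm ?l2norm_ge0//.
  have [->|z0] := eqVneq (l2norm z) 0; first by rewrite mulr0 expr0n.
  by rewrite mulVf// expr1n.
have [z0|z0] := eqVneq (l2norm z) 0; last by rewrite scalerA divff// scale1r.
by rewrite z0 scale0r; exact: l2norm_eq0.
Qed.

End EuclideanNorm.

Section Deviation.
Variables (R : realType) (m n : nat).
Implicit Types (M : 'M[R]_(m, n)) (x y e : 'cV[R]_n).

Definition deviation M x : R := l2norm (M *m x) - l2norm x.

Lemma deviation0 M : deviation M 0 = 0.
Proof. by rewrite /deviation mulmx0 !l2norm0 subr0. Qed.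

Lemma deviation_increment_crude M x y :
  `|deviation M x - deviation M y| <= l2norm (M *m (x - y)) + l2norm (x - y).
Proof.
have -> : deviation M x - deviation M y =
    (l2norm (M *m x) - l2norm (M *m y)) - (l2norm x - l2norm y).
  by rewrite /deviation; ring.
apply: le_trans (ler_normB _ _) _; rewrite lerD ?ler_dist_l2norm//.
by rewrite mulmxBr ler_dist_l2norm.
Qed.

(* On unit vectors [|Mx| - |My|] is [(|Mx|^2 - |My|^2) / (|Mx| + |My|)], whose
   numerator is a purely off-diagonal Gram form because [x - y] and [x + y] are
   orthogonal; the denominator is only useful when [|Mx|] is not small. *)
Lemma deviation_increment x y e : l2norm e = 1 -> exists xh yh h s,
  [/\ l2norm xh = 1, l2norm yh = 1, dotv h h <= 1, dotv s s <= 1 &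
   forall M, `|deviation M x - deviation M y| <= l2norm (x - y) *
     (2 * (if 2^-1 <= l2norm (M *m xh) then 4 * `|gram_excess M h s|
           else l2norm (M *m h)) + `|gram_excess M yh yh|)].
Proof.
move=> e1; have [xh xh1 xE] := l2norm_unit_decomp x e1.
have [yh yh1 yE] := l2norm_unit_decomp y e1.
have [] := l2norm_normalize (xh - yh); set h := _ *: _ => h1 zE.
(* Halving the sum puts [s] in the unit ball, where the moment bounds hold; [h] is the normalized
   difference, orthogonal to [s]. *)
pose s : 'cV[R]_n := 2^-1 *: (xh + yh).
have s1 : dotv s s <= 1.
  rewrite -sqr_l2norm l2normZ normfV ger0_norm//.
  rewrite expr_le1 ?mulr_ge0 ?l2norm_ge0 ?invr_ge0// ler_pdivrMl// mulr1.
  by rewrite (le_trans (ler_l2normD _ _))// xh1 yh1.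
exists xh, yh, h, s; split => // M.
set a := l2norm x in xE *; set b := l2norm y in yE *; set r := l2norm (x - y).
set z := l2norm (xh - yh) in zE.
have a0 : 0 <= a by exact: l2norm_ge0.
have b0 : 0 <= b by exact: l2norm_ge0.
have z0 : 0 <= z by exact: l2norm_ge0.
have r0 : 0 <= r by exact: l2norm_ge0.
have abr : `|a - b| <= r by exact: ler_dist_l2norm.
(* Comparing directions costs a factor 2: [a *: xh - a *: yh] is x - y plus the radial correction
   [(b - a) *: yh], each of norm at most [r]. *)
have azr : a * z <= 2 * r.
  have -> : a * z = l2norm ((x - y) + (b - a) *: yh).
    rewrite -{1}(ger0_norm a0) /z -l2normZ; congr l2norm.
    rewrite [in RHS]xE [in RHS]yE scalerBr scalerBl.
    by rewrite addrA subrK.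
  rewrite (le_trans (ler_l2normD _ _))// l2normZ yh1 mulr1 -/r distrC.
  by move: abr; lra.
set p := l2norm (M *m xh); set q := l2norm (M *m yh).
have Dx : deviation M x = a * p - a.
  by rewrite /deviation -/a {1}xE -scalemxAr l2normZ ger0_norm.
have Dy : deviation M y = b * q - b.
  by rewrite /deviation -/b {1}yE -scalemxAr l2normZ ger0_norm.
have p0 : 0 <= p by exact: l2norm_ge0.
have q0 : 0 <= q by exact: l2norm_ge0.
have q1 : `|q - 1| <= `|gram_excess M yh yh|.
  rewrite /gram_excess -!sqr_l2norm yh1 -/q expr1n.
  have -> : q ^+ 2 - 1 = (q - 1) * (q + 1) by ring.
  by rewrite normrM ler_peMr// ger0_norm ?addr_ge0// lerDr.
have hs : dotv h s = 0.
  rewrite /h /s dotvZl dotvZr dotvDr !dotvDl !dotvNl -!sqr_l2norm xh1 yh1.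
  by rewrite (dotvC yh); ring.
set dl := (if _ then _ else _).
have pq : `|p - q| <= z * dl.
  rewrite /dl; case: ifP => hp; last first.
    rewrite (le_trans (ler_dist_l2norm _ _))// -mulmxBr zE -scalemxAr l2normZ.
    by rewrite ger0_norm.
  (* By orthogonality of [h] and [s] the difference of squares is a pure Gram excess. Dividing by
     [p + q], at least 1/2 in this branch, turns the factor 2 into 4. *)
  have e2 : (p - q) * (p + q) = 2 * z * gram_excess M h s.
    rewrite /gram_excess hs subr0 -mulrA -dotvZl scalemxAr -zE -subr_sqr.
    rewrite /p /q !sqr_l2norm /s -scalemxAr dotvZr mulrA divff// mul1r.
    rewrite mulmxBr mulmxDr dotvDr !dotvDl !dotvNl (dotvC (M *m yh)); ring.
  have := congr1 Num.norm e2; rewrite !normrM (ger0_norm z0) normr_nat.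
  rewrite (ger0_norm (addr_ge0 p0 q0)).
  have n0 : 0 <= `|p - q| by [].
  by move: (`|p - q|) n0 (`|gram_excess M h s|) => t t0 g; nra.
(* Split into an angular part, controlled by [pq] and [azr], and a radial part, controlled by [abr]
   and [q1]. *)
rewrite Dx Dy (_ : _ - _ = a * (p - q) + (a - b) * (q - 1)); last by ring.
rewrite (le_trans (ler_normD _ _))// !normrM (ger0_norm a0).
have dl0 : 0 <= dl by rewrite /dl; case: ifP => _; rewrite ?mulr_ge0 ?l2norm_ge0.
have h2 : a * `|p - q| <= 2 * r * dl.
  by rewrite (le_trans (ler_wpM2l a0 pq))// mulrA ler_wpM2r.
have h3 : `|a - b| * `|q - 1| <= r * `|gram_excess M yh yh| by rewrite ler_pM.
by lra.
Qed.

End Deviation.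

(** * Moments and tails of the increments *)

Section IncrementMoments.
Variables (R : realType) (m n : nat) (d : measure_display).
Variables (Omega : measurableType d) (P : probability Omega R).
Variable A : Omega -> 'M[R]_(m, n).
Hypothesis mA : random_matrix A.
Hypothesis normA : forall i, {ae P, forall w, l2norm (col i (A w)) = 1}.
Variables (k : nat) (a : R).
Hypothesis k0 : (0 < k)%N.
Hypothesis a0 : 0 < a.
Let E := Ex P A.
Hypothesis norm1 : forall v : 'cV[R]_n, dotv v v <= 1 ->
  E (fun M => dotv (M *m v) (M *m v) ^+ k) <= 4 ^+ k * (1 + a ^+ k).
Hypothesis gram1 : forall u v : 'cV[R]_n, dotv u u <= 1 -> dotv v v <= 1 ->
  E (fun M => gram_excess M u v ^+ k.*2) <= a ^+ k * (4 ^+ k * (1 + a ^+ k)).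
Hypothesis norm2 : forall v : 'cV[R]_n, dotv v v <= 1 ->
  E (fun M => dotv (M *m v) (M *m v) ^+ k.*2) <= 4 ^+ k.*2 * (1 + a ^+ k.*2).
Hypothesis gram2 : forall u v : 'cV[R]_n, dotv u u <= 1 -> dotv v v <= 1 ->
  E (fun M => gram_excess M u v ^+ k.*2.*2) <=
    a ^+ k.*2 * (4 ^+ k.*2 * (1 + a ^+ k.*2)).

Let sqr_expr (x : R) : x ^+ k.*2 = (x ^+ k) ^+ 2.
Proof. by rewrite expr_double -!exprM mulnC. Qed.

Let leX (c p q : R) : 1 <= c -> 0 <= p -> c * p <= q -> c * p ^+ k <= q ^+ k.
Proof.
move=> c1 p0 cpq; have c0 : 0 <= c by apply: le_trans c1.
apply: (@le_trans _ _ ((c * p) ^+ k)); last first.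
  by rewrite lerXn2r ?nnegrE ?mulr_ge0// (le_trans _ cpq)// mulr_ge0.
by rewrite exprMn ler_wpM2r ?exprn_ge0// ler_eXnr.
Qed.

(** When |M xh| < 1/2 the Gram excess of [xh] exceeds 3/4 in absolute value, so a power of it can be
    inserted as a Markov factor next to |Mh|^(2k). AM-GM separates the two, which is why moments of
    double order are assumed. The majorant [F] is polynomial in the entries, hence tame. *)
Let small_increment_moment (xh yh h s : 'cV[R]_n) : a <= 1 ->
  l2norm xh = 1 -> l2norm yh = 1 -> dotv h h <= 1 -> dotv s s <= 1 ->
  exists F, [/\ tame F, E F <= (2 ^+ 11 * a) ^+ k & forall M,
    (2 * (if 2^-1 <= l2norm (M *m xh) then 4 * `|gram_excess M h s|
           else l2norm (M *m h)) + `|gram_excess M yh yh|) ^+ k.*2 <= 4 ^+ k * F M].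
Proof.
move=> a1 xh1 yh1 h1 s1; set b := a ^+ k.
have b0 : 0 < b by rewrite exprn_gt0.
have b1 : b <= 1 by rewrite exprn_ile1// ltW.
have b0' := ltW b0.
have xx : dotv xh xh <= 1 by rewrite -sqr_l2norm xh1 expr1n.
have yy : dotv yh yh <= 1 by rewrite -sqr_l2norm yh1 expr1n.
pose G1 (M : 'M[R]_(m, n)) := gram_excess M h s ^+ k.*2 : R.
pose G2 (M : 'M[R]_(m, n)) := dotv (M *m h) (M *m h) ^+ k.*2 : R.
pose G3 (M : 'M[R]_(m, n)) := gram_excess M xh xh ^+ k.*2.*2 : R.
pose G4 (M : 'M[R]_(m, n)) := gram_excess M yh yh ^+ k.*2 : R.
have tQ (u v : 'cV[R]_n) j : tame (fun M : 'M[R]_(m, n) => gram_excess M u v ^+ j).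
  by apply: tameX; exact: tame_gram_excess.
have t1 : @tame R m n G1 by exact: tQ.
have t2 : tame G2 by rewrite /G2; tame.
have t3 : @tame R m n G3 by exact: tQ.
have t4 : @tame R m n G4 by exact: tQ.
(* The factors [4 ^+ k] and [16 ^+ k] are the 2k-th powers of the 2 and the 4 in the increment
   bound, and 16/9 is (4/3)^2. The AM-GM weight [b] balances a moment of order 1 ([G2]) against one
   of order [b ^+ 2] ([G3]), so that both end at order [b]. *)
pose c1 : R := 4 ^+ k * 16 ^+ k.
pose c2 : R := 4 ^+ k * ((16 / 9) ^+ k * (2^-1 * b)).
pose c3 : R := 4 ^+ k * ((16 / 9) ^+ k * (2^-1 * b^-1)).
exists (fun M => c1 * G1 M + c2 * G2 M + c3 * G3 M + G4 M); split.
- by do !apply: tameD => //; apply: tameM => //; exact: tame_cst.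
- have tc c G : @tame R m n G -> tame (fun M => c * G M).
    by move=> tG; apply: tameM => //; exact: tame_cst.
  rewrite /E !(ExD mA normA) ?(ExZ mA normA)//; try by do ?[exact: tc|apply: tameD].
  have B1 : Ex P A G1 <= b * (4 ^+ k * 2).
    apply: le_trans (gram1 h1 s1) _; rewrite ler_wpM2l ?(ltW b0)//.
    by rewrite ler_wpM2l ?exprn_ge0// -/b; lra.
  have B4 : Ex P A G4 <= b * (4 ^+ k * 2).
    apply: le_trans (gram1 yy yy) _; rewrite ler_wpM2l ?(ltW b0)//.
    by rewrite ler_wpM2l ?exprn_ge0// -/b; lra.
  have bb1 : b ^+ 2 <= 1 by rewrite expr_le1.
  have e16 : 4 ^+ k.*2 = 16 ^+ k :> R by rewrite expr_double expr2 -natrM.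
  have B2 : Ex P A G2 <= 16 ^+ k * 2.
    apply: le_trans (norm2 h1) _; rewrite e16 ler_wpM2l ?exprn_ge0//.
    by rewrite [a ^+ _]sqr_expr -/b; lra.
  have B3 : Ex P A G3 <= b ^+ 2 * (16 ^+ k * 2).
    apply: le_trans (gram2 xx xx) _; rewrite e16 [a ^+ _]sqr_expr -/b.
    rewrite ler_wpM2l ?sqr_ge0// ler_wpM2l ?exprn_ge0//; lra.
  have c10 : 0 <= c1 by rewrite /c1 mulr_ge0 ?exprn_ge0.
  have p169 : 0 <= (16 / 9) ^+ k :> R by apply: exprn_ge0; lra.
  have c20 : 0 <= c2 by rewrite !mulr_ge0 ?p169 ?exprn_ge0 ?invr_ge0 ?(ltW a0).
  have c30 : 0 <= c3 by rewrite !mulr_ge0 ?p169 ?exprn_ge0 ?invr_ge0 ?exprn_ge0 ?(ltW a0).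
  apply: (@le_trans _ _ (c1 * (b * (4 ^+ k * 2)) + c2 * (16 ^+ k * 2) +
     c3 * (b ^+ 2 * (16 ^+ k * 2)) + b * (4 ^+ k * 2))).
    by rewrite !lerD ?ler_wpM2l.
  have -> : c1 * (b * (4 ^+ k * 2)) = b * (2 * (2 ^+ 8) ^+ k).
    by rewrite (_ : 2 ^+ 8 = 4 * 16 * 4) ?exprMn ?/c1; [ring|lra].
  have e : c2 * (16 ^+ k * 2) = b * (4 * (16 / 9) * 16) ^+ k.
    rewrite [in RHS]exprMn [(4 * _) ^+ k]exprMn /c2.
    by move: (4 ^+ k) (16 ^+ k) ((16 / 9) ^+ k) => x y z; field.
  have -> : c3 * (b ^+ 2 * (16 ^+ k * 2)) = b * (4 * (16 / 9) * 16) ^+ k.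
    rewrite [in RHS]exprMn [(4 * _) ^+ k]exprMn /c3.
    by move: (4 ^+ k) (16 ^+ k) ((16 / 9) ^+ k) => x y z; field; rewrite gt_eqF.
  rewrite e.
  have l1 : (4 * (16 / 9) * 16) ^+ k <= (2 ^+ 8) ^+ k :> R.
    by rewrite lerXn2r ?nnegrE; lra.
  have l2 : 4 ^+ k <= (2 ^+ 8) ^+ k :> R by rewrite lerXn2r ?nnegrE; lra.
  (* The four terms contribute 2 + 1 + 1 + 2 copies of [(2 ^+ 8) ^+ k], and 6 * 2^8 is at most 2^11;
     [leX] absorbs the 6 since [k] is positive. *)
  have l3 : 6 * (2 ^+ 8) ^+ k <= 2 ^+ 11 ^+ k :> R by by apply: leX; lra.
  rewrite [leRHS]exprMn -/b [leRHS]mulrC.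
  apply: (@le_trans _ _ (b * (6 * (2 ^+ 8) ^+ k))); last by rewrite ler_pM2l.
  rewrite -!mulrDr ler_pM2l//.
  by move: l1 l2; move: (_ ^+ k) ((2 ^+ 8) ^+ k) (4 ^+ k) => x y z; lra.
- move=> M; set dl := (if _ then _ else _).
  apply: le_trans (exprn_doubleD_le _ _ _) _; rewrite ler_wpM2l ?exprn_ge0//.
  have -> : `|gram_excess M yh yh| ^+ k.*2 = G4 M.
    by rewrite /G4 expr_double real_normK ?num_real// -expr_double.
  rewrite lerD2r exprMn (_ : 2 ^+ k.*2 = 4 ^+ k); last first.
    by rewrite expr_double expr2 -natrM.
  have G20 : 0 <= G2 M by rewrite exprn_even_doublege0.
  have G30 : 0 <= G3 M by rewrite exprn_even_doublege0.
  have G10 : 0 <= G1 M by rewrite exprn_even_doublege0.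
  have p0 : 0 <= (16 / 9) ^+ k :> R by apply: exprn_ge0; lra.
  have q0 : 0 <= (16 / 9) ^+ k * (2^-1 * b) by rewrite !mulr_ge0 ?invr_ge0.
  have q1 : 0 <= (16 / 9) ^+ k * (2^-1 * b^-1) by rewrite !mulr_ge0 ?invr_ge0.
  rewrite /c1 /c2 /c3 -!mulrA -!mulrDr ler_wpM2l ?exprn_ge0// /dl.
  case: ifP => [_|hlt].
    rewrite exprMn (_ : 4 ^+ k.*2 = 16 ^+ k); last by rewrite expr_double expr2 -natrM.
    rewrite [X in _ * X <= _]expr_double real_normK ?num_real// -expr_double -/(G1 M).
    have := mulr_ge0 q0 G20; have := mulr_ge0 q1 G30; rewrite -!mulrA => u1 u2.
    by rewrite -addrA lerDl addr_ge0.
  have Q34 : 3 / 4 <= `|gram_excess M xh xh|.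
    rewrite /gram_excess -!sqr_l2norm xh1 expr1n.
    have hlt' : l2norm (M *m xh) < 2^-1 by rewrite ltNge hlt.
    have := l2norm_ge0 (M *m xh); move: (l2norm _) hlt' => t t1' t0.
    by rewrite ler0_norm; nra.
  have q34 : 1 <= (16 / 9) ^+ k * gram_excess M xh xh ^+ k.*2.
    rewrite expr_double -exprMn exprn_ege1//.
    rewrite -(real_normK (num_real (gram_excess M xh xh))).
    by move: (`|_|) Q34 => t t1'; nra.
  have -> : l2norm (M *m h) ^+ k.*2 = dotv (M *m h) (M *m h) ^+ k.
    by rewrite expr_double sqr_l2norm.
  have G2E : G2 M = (dotv (M *m h) (M *m h) ^+ k) ^+ 2 by rewrite /G2 sqr_expr.
  have G3E : G3 M = (gram_excess M xh xh ^+ k.*2) ^+ 2.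
    by rewrite /G3 -exprM muln2.
  have w0 : 0 <= dotv (M *m h) (M *m h) ^+ k by rewrite exprn_ge0// dotvv_ge0.
  rewrite G2E G3E in G20 G30 *.
  move: (dotv _ _ ^+ k) (gram_excess M xh xh ^+ k.*2) w0 q34 => w q w0 q34.
  apply: (@le_trans _ _ ((16 / 9) ^+ k * (2^-1 * (b * w ^+ 2 + b^-1 * q ^+ 2)))); last first.
    have : 0 <= 16 ^+ k * G1 M by apply: mulr_ge0 => //; exact: exprn_ge0.
    by move: (16 ^+ k * G1 M) ((16 / 9) ^+ k) => x y; lra.
  apply: (@le_trans _ _ ((16 / 9) ^+ k * (w * q))).
    by rewrite mulrCA ler_peMr.
  rewrite ler_wpM2l// -subr_ge0.
  have -> : 2^-1 * (b * w ^+ 2 + b^-1 * q ^+ 2) - w * q =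
     2^-1 * b^-1 * (b * w - q) ^+ 2 by field; rewrite gt_eqF.
  by apply: mulr_ge0; [rewrite mulr_ge0 ?invr_ge0|exact: sqr_ge0].
Qed.

(** Two regimes. If [a > 1], the crude bound |M(x-y)| + |x-y| already has moments of order [a ^+ k].
    If [a <= 1], the smallness must come from the Gram excess, through [small_increment_moment];
    2^13 is its 2^11 times the 4 lost in splitting a sum. *)
Lemma deviation_increment_moment (x y : 'cV[R]_n) : exists F, [/\ tame F,
  E F <= (2 ^+ 13 * a * dotv (x - y) (x - y)) ^+ k & forall M,
   (deviation M x - deviation M y) ^+ k.*2 <= F M].
Proof.
have normX (z : R) : `|z| ^+ k.*2 = z ^+ k.*2.
  by rewrite expr_double real_normK ?num_real// -expr_double.
have [xy|xy] := eqVneq (l2norm (x - y)) 0.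
  have {}xy : x = y by apply/eqP; rewrite -subr_eq0; apply/eqP; exact: l2norm_eq0.
  exists (fun=> 0); split; first exact: tame_cst.
  - by rewrite /E Ex_cst exprn_ge0// !mulr_ge0 ?dotvv_ge0 ?(ltW a0).
  - by move=> M; rewrite xy subrr expr0n double_eq0 (gtn_eqF k0).
set r := l2norm (x - y) in xy.
have r0 : 0 <= r by exact: l2norm_ge0.
have rr : dotv (x - y) (x - y) = r ^+ 2 by rewrite sqr_l2norm.
have [a1|a1] := leP a 1; last first.
  have [h1 zE] := l2norm_normalize (x - y); rewrite -/r in h1 zE.
  set h := r^-1 *: (x - y) in h1 zE.
  exists (fun M => 4 ^+ k * (r ^+ 2) ^+ k * (dotv (M *m h) (M *m h) ^+ k + 1)); split.
  - by tame.
  - rewrite /E (ExZ mA normA); last by tame.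
    rewrite (ExD mA normA) ?Ex_cst; [|by tame..].
    have ak1 : 1 <= a ^+ k by rewrite exprn_ege1// ltW.
    have k41 : 1 <= 4 ^+ k :> R by rewrite exprn_ege1// ler1n.
    have -> : (2 ^+ 13 * a * dotv (x - y) (x - y)) ^+ k =
        (r ^+ 2) ^+ k * ((2 ^+ 13) ^+ k * a ^+ k).
      by rewrite rr [LHS]exprMn [(_ * a) ^+ k]exprMn mulrC.
    rewrite [4 ^+ k * _]mulrC -mulrA ler_wpM2l ?exprn_ge0 ?sqr_ge0//.
    apply: (@le_trans _ _ (4 ^+ k * (3 * 4 ^+ k * a ^+ k))).
      rewrite ler_wpM2l ?exprn_ge0//.
      apply: le_trans (lerD (norm1 h1) (lexx 1)) _.
      by move: (4 ^+ k) (a ^+ k) k41 ak1 => p q; nra.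
    rewrite mulrA ler_wpM2r ?exprn_ge0 ?(ltW a0)//.
    have -> : 4 ^+ k * (3 * 4 ^+ k) = 3 * (16 ^+ k) :> R.
      by rewrite (_ : 16 = 4 * 4 :> R) ?exprMn; [ring|lra].
    by apply: leX; lra.
  - move=> M; rewrite -normX.
    apply: (@le_trans _ _ ((l2norm (M *m (x - y)) + r) ^+ k.*2)).
      by rewrite lerXn2r ?nnegrE ?addr_ge0 ?l2norm_ge0// deviation_increment_crude.
    apply: le_trans (exprn_doubleD_le _ _ _) _.
    rewrite -mulrA ler_wpM2l ?exprn_ge0// zE -scalemxAr l2normZ (ger0_norm r0).
    rewrite exprMn !expr_double sqr_l2norm mulrDr mulr1.
    by rewrite [l2norm (M *m h) ^+ 2]sqr_l2norm.
have [e e1] : exists e : 'cV[R]_n, l2norm e = 1.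
  exists (r^-1 *: (x - y)).
  by rewrite l2normZ -/r normfV ger0_norm// mulVf.
have [xh [yh [h [s [xh1 yh1 h1 s1 H]]]]] := deviation_increment m x y e1.
have [F [tF EF HF]] := small_increment_moment a1 xh1 yh1 h1 s1.
exists (fun M => (r ^+ 2) ^+ k * (4 ^+ k * F M)); split.
- by do 2 (apply: tameM; first exact: tame_cst).
- rewrite /E !(ExZ mA normA)//; last by apply: tameM => //; exact: tame_cst.
  rewrite rr [leRHS]exprMn [leRHS]mulrC ler_wpM2l ?exprn_ge0 ?sqr_ge0//.
  rewrite (_ : 2 ^+ 13 * a = 4 * (2 ^+ 11 * a)); last by ring.
  by rewrite [leRHS]exprMn ler_wpM2l ?exprn_ge0.
- move=> M; rewrite -normX.
  apply: le_trans (@lerXn2r _ k.*2 _ _ _ _ (H M)) _; rewrite ?nnegrE//.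
    by rewrite (le_trans _ (H M)).
  rewrite exprMn -/r expr_double ler_wpM2l ?exprn_ge0 ?sqr_ge0//.
Qed.

Lemma deviation_measurable (x : 'cV[R]_n) :
  measurable_fun setT (fun w => deviation (A w) x).
Proof.
apply: measurable_funB; last exact: measurable_cst.
have msqrt : measurable_fun setT (@Num.sqrt R).
  by apply: continuous_measurable_fun; exact: sqrt_continuous.
apply: (measurableT_comp msqrt).
by apply: (tame_measurable mA (f := fun M => dotv (M *m x) (M *m x))); tame.
Qed.

(** Markov's inequality at order 2k: the condition on [B] leaves a factor e^2 to spare under the
    k-th power. *)
Lemma deviation_increment_tail (x y : 'cV[R]_n) (B : R) :
  expR 1 ^+ 2 * (2 ^+ 13 * a) <= B ^+ 2 -> 0 <= B ->
  (P [set w | (B * l2norm (x - y) < `|deviation (A w) x - deviation (A w) y|)%R]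
   <= (expR (- k.*2%:R))%:E)%E.
Proof.
move=> HB B0; set S := [set w | _]; set r := l2norm (x - y).
have e0 : 0 < expR 1 ^+ 2 :> R by rewrite exprn_gt0// expR_gt0.
have Bp : 0 < B.
  rewrite lt_neqAle B0 andbT eq_sym; apply/eqP => BE; move: HB.
  by rewrite BE expr0n /= leNgt mulr_gt0// mulr_gt0.
have [xy|xy] := eqVneq r 0.
  have xyE : x = y by apply/eqP; rewrite -subr_eq0; apply/eqP; exact: l2norm_eq0.
  rewrite (_ : S = set0) ?measure0 ?lee_fin ?expR_ge0//.
  by apply/seteqP; split => w //=; rewrite /S/= xyE !subrr l2norm0 normr0 mulr0 ltxx.
have rp : 0 < r by rewrite lt_neqAle eq_sym xy l2norm_ge0.
have [F [tF EF HF]] := deviation_increment_moment x y.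
have lam0 : 0 < (B * r) ^+ k.*2 by rewrite exprn_gt0// mulr_gt0.
have mS : measurable S.
  rewrite -[S]setTI; apply: measurable_fun_ltr => //.
  - exact: measurableT_comp (measurable_funB (deviation_measurable x) (deviation_measurable y)).
have step : (((B * r) ^+ k.*2)%:E * P S <= (E F)%:E)%E.
  rewrite (EFin_Ex mA normA tF) -[X in P X]setIT -integral_indic// -ge0_integralZl//; last 2 first.
    exact: measurableT_comp.
    by rewrite lee_fin ltW.
  apply: ge0_le_integral => //.
  - by move=> w _; rewrite -EFinM lee_fin mulr_ge0// ltW.
  - by apply: measurable_funeM; exact: measurableT_comp.
  - by apply/measurable_EFinP; exact: tame_measurable.
  - move=> w _; rewrite -EFinM lee_fin (le_trans _ (HF (A w)))//.
    rewrite indicE; case: (boolP (w \in S)) => [|_].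
      rewrite inE => Sw; rewrite mulr1 -[leRHS](_ : `|deviation (A w) x - deviation (A w) y| ^+ k.*2 = _).
        by rewrite lerXn2r ?nnegrE ?mulr_ge0 ?(ltW Bp) ?(ltW rp)// ltW.
      by rewrite expr_double real_normK ?num_real// -expr_double.
    by rewrite mulr0 exprn_even_doublege0.
have : (((B * r) ^+ k.*2)%:E * P S <= ((B * r) ^+ k.*2)%:E * (expR (- k.*2%:R))%:E)%E.
  apply: le_trans step _; rewrite -EFinM lee_fin (le_trans EF)//.
  have -> : expR (- k.*2%:R) = ((expR 1 ^+ 2) ^+ k)^-1 :> R.
    by rewrite expRN -exprM mul2n -expRM_natl mulr1.
  rewrite ler_pdivlMr ?exprn_gt0// -exprMn [leRHS]expr_double.
  apply: lerXn2r; rewrite ?nnegrE ?sqr_ge0//.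
    by rewrite !mulr_ge0 ?dotvv_ge0 ?expR_ge0 ?(ltW a0).
  by rewrite [leRHS]exprMn sqr_l2norm mulrAC ler_wpM2r ?dotvv_ge0// mulrC.
by rewrite lee_pmul2l// lte_fin.
Qed.

End IncrementMoments.

(** * Moments of psi_alpha variables *)

Section RealPowers.
Variable R : realType.

Lemma expR1_le4 : expR 1 <= 4 :> R.
Proof.
have h : 2^-1 <= expR (- 2^-1) :> R.
  by apply: le_trans (expR_ge1Dx _); lra.
have e0 : 0 < expR 2^-1 :> R by exact: expR_gt0.
have h2 : expR 2^-1 <= 2 :> R.
  by move: h; rewrite expRN lef_pV2// posrE.
have -> : expR 1 = expR 2^-1 * expR 2^-1 :> R by rewrite -expRD; congr expR; lra.
by rewrite (_ : 4 = 2 * 2); [rewrite ler_pM// ltW|lra].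
Qed.

(** From y/q <= exp(y/q), raised to the power q. It serves twice: to extract moments from the
    psi_alpha norm, and to sum the failure probabilities in the expectation bound. *)
Lemma powR_le_expR (q y : R) : 0 < q -> 0 <= y -> y `^ q <= q `^ q * expR y.
Proof.
move=> q0 y0; have -> : y = q * (y / q) by rewrite mulrC divfK// gt_eqF.
have yq : 0 <= y / q by rewrite divr_ge0// ltW.
rewrite powRM ?(ltW q0)// ler_wpM2l ?powR_ge0//.
have -> : expR (q * (y / q)) = expR (y / q) `^ q.
  by rewrite -expRM mulrC.
apply: ge0_ler_powR; rewrite ?nnegrE ?expR_ge0 ?(ltW q0)//.
by apply: le_trans (expR_ge1Dx _); rewrite lerDr.
Qed.

End RealPowers.

Section PsiMoments.
Variables (R : realType) (d : measure_display).
Variables (Omega : measurableType d) (P : probability Omega R).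
Variables (alpha K : R).
Hypothesis alpha0 : 0 < alpha.
Hypothesis K0 : 0 < K.

(** Apply [powR_le_expR] to y = |X/s|^alpha with q = 2l/alpha, so that y^q = (X/s)^(2l). The strict
    inequality on [t] supplies an admissible [s < t] whether or not the infimum is attained. *)
Lemma psi_norm_moment_le (X : Omega -> R) (l : nat) (t : R) :
  measurable_fun setT X -> (0 < l)%N -> (psi_norm P alpha X < t%:E)%E ->
  (\int[P]_w (X w ^+ l.*2)%:E <=
   (2 * t ^+ l.*2 * (l%:R * (2 / alpha)) `^ (l%:R * (2 / alpha)))%:E)%E.
Proof.
move=> mX l0 /ereal_inf_lt[_ [s [s0 Es] <-]]; rewrite lte_fin => st.
set q := l%:R * (2 / alpha).
have q0 : 0 < q by rewrite mulr_gt0 ?ltr0n// divr_gt0.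
set e := fun w => expR (`|X w / s| `^ alpha).
have me : measurable_fun setT e.
  apply: measurableT_comp; first exact: measurable_expR.
  apply: (measurableT_comp (f := fun x => x `^ alpha)); first exact: measurable_powR.
  by apply: measurableT_comp => //; apply: measurable_funM => //; exact: measurable_cst.
apply: (@le_trans _ _ (\int[P]_w ((s ^+ l.*2 * q `^ q)%:E * (e w)%:E))%E).
  apply: ge0_le_integral => //.
  - by move=> w _; rewrite lee_fin exprn_even_doublege0.
  - by apply/measurable_EFinP; exact: measurable_funX.
  - by apply: measurable_funeM; exact/measurable_EFinP.
  - move=> w _; rewrite -EFinM lee_fin -mulrA.
    have -> : X w ^+ l.*2 = s ^+ l.*2 * (`|X w / s| `^ alpha) `^ q.
      rewrite -powRrM (_ : alpha * q = l.*2%:R); last first.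
        by rewrite /q -mul2n natrM; field; rewrite gt_eqF.
      rewrite powR_mulrn// !expr_double real_normK ?num_real// -exprMn.
      by congr (_ ^+ _); field; rewrite gt_eqF.
    by rewrite ler_wpM2l ?exprn_even_doublege0// powR_le_expR// powR_ge0.
have c0 : 0 <= s ^+ l.*2 * q `^ q by rewrite mulr_ge0 ?powR_ge0 ?exprn_even_doublege0.
have -> : (\int[P]_w ((s ^+ l.*2 * q `^ q)%:E * (e w)%:E) =
    (s ^+ l.*2 * q `^ q)%:E * \int[P]_w (e w)%:E)%E.
  apply: ge0_integralZl => //; first exact/measurable_EFinP.
  by move=> w _; rewrite lee_fin expR_ge0.
move: Es; rewrite unlock => Es.
apply: le_trans (lee_wpmul2l _ Es) _; first by rewrite lee_fin.
rewrite -EFinM lee_fin mulrC mulrA ler_wpM2r ?powR_ge0//.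
by rewrite ler_pM2l// lerXn2r ?nnegrE ?(ltW s0)// ltW// (lt_trans s0).
Qed.

(** The 4 comes from applying the previous bound at 2K, strictly above the norm. The value at 0 is
    set to 1 because the peeling hypothesis at [l = 0] leaves no room for the factor 2. *)
Definition psi_moment_const (l : nat) : R :=
  if l == 0%N then 1 else
  2 * (4 * K ^+ 2) ^+ l * (l%:R * (2 / alpha)) `^ (l%:R * (2 / alpha)).

Lemma psi_norm_vec_moment_le m (X : Omega -> 'cV[R]_m) (l : nat) (v : 'cV[R]_m) :
  (forall j, measurable_fun setT (fun w => X w j 0)) ->
  (psi_norm_vec P alpha X <= K%:E)%E ->
  (\int[P]_w (dotv (X w) v ^+ l.*2)%:E <=
   (psi_moment_const l * dotv v v ^+ l)%:E)%E.
Proof.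
move=> mX XK; rewrite /psi_moment_const; case: eqP => [->|/eqP l0].
  rewrite expr0 mulr1; under eq_integral do rewrite expr0.
  by rewrite integral_cst// mul1e; exact: (probability_le1 P).
rewrite -lt0n in l0.
have [v0|v0] := eqVneq (l2norm v) 0.
  rewrite (l2norm_eq0 v0); under eq_integral do
    rewrite dotvC dotv0l expr0n double_eq0 (gtn_eqF l0).
  by rewrite integral0 dotv0l expr0n (gtn_eqF l0) mulr0.
have vE : v = l2norm v *: ((l2norm v)^-1 *: v) by rewrite scalerA divff// scale1r.
set x := (l2norm v)^-1 *: v in vE.
have x1 : l2norm x = 1.
  by rewrite /x l2normZ normfV ger0_norm ?l2norm_ge0// mulVf.
have mXx : measurable_fun setT (fun w => dotv (X w) x).
  rewrite /dotv; apply: measurable_sum => j.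
  by apply: measurable_funM => //; exact: measurable_cst.
have Hx : (psi_norm P alpha (fun w => dotv (X w) x) < (2 * K)%:E)%E.
  apply: (@le_lt_trans _ _ K%:E); last by rewrite lte_fin ltr_pMl// ltr1n.
  by apply: le_trans XK; apply: ereal_sup_ubound; exists x.
have := psi_norm_moment_le mXx l0 Hx.
set c := (2 * _ * _) => H.
have -> : (\int[P]_w (dotv (X w) v ^+ l.*2)%:E =
    (dotv v v ^+ l)%:E * \int[P]_w (dotv (X w) x ^+ l.*2)%:E)%E.
  rewrite -ge0_integralZl//; first last.
  - by rewrite lee_fin exprn_ge0// dotvv_ge0.
  - by move=> w _; rewrite lee_fin exprn_even_doublege0.
  - by apply/measurable_EFinP; exact: measurable_funX.
  apply: eq_integral => w _; rewrite -EFinM; congr EFin.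
  by rewrite {1}vE dotvZr exprMn expr_double sqr_l2norm.
rewrite mulrC EFinM lee_wpmul2l ?lee_fin ?exprn_ge0 ?dotvv_ge0//.
apply: le_trans H _; rewrite lee_fin /c le_eqVlt; apply/orP; left; apply/eqP.
congr (_ * _ * _); rewrite expr_double; congr (_ ^+ _).
by rewrite exprMn expr2 -natrM.
Qed.

(** With g = 2/alpha, (lg)^(lg) is g^(gl) l^l l^((g-1)l). The factor l^l goes into (2l)!/l!, and
    [alpha <= 2], that is g >= 1, allows l^(g-1) to be replaced by k0^(g-1). The 24 is 3 * 2 * 4:
    the [3 ^+ l], the leading 2 and the 4 of [psi_moment_const]. *)
Lemma psi_moment_const_le (k0 l : nat) : alpha <= 2 -> (l <= k0)%N ->
  3 ^+ l * psi_moment_const l <= (l.*2 ^_ l)%:R *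
   (24 * K ^+ 2 * (2 / alpha) `^ (2 / alpha) * k0%:R `^ (2 / alpha - 1)) ^+ l.
Proof.
move=> alpha2 lk; rewrite /psi_moment_const; case: eqP => [->|/eqP l0].
  by rewrite !expr0 ffactn0 mulr1.
rewrite -lt0n in l0; set g := 2 / alpha.
have g0 : 0 < g by rewrite divr_gt0.
have g1 : 0 <= g - 1 by rewrite subr_ge0 ler_pdivlMr// mul1r.
have lr0 : 0 < l%:R :> R by rewrite ltr0n.
have -> : (l%:R * g) `^ (l%:R * g) = (g `^ g) ^+ l * (l%:R ^+ l * (l%:R `^ (g - 1)) ^+ l).
  rewrite mulrC powRrM powR_mulrn ?powR_ge0// powRM ?(ltW g0) ?ler0n//.
  rewrite [in LHS]exprMn; congr (_ * _); rewrite -exprMn; congr (_ ^+ _).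
  by rewrite mulr_powRB1// ler0n.
have h1 : l%:R ^+ l <= (l.*2 ^_ l)%:R :> R.
  by rewrite -natrX ler_nat expn_le_ffact_double.
have h2 : (l%:R `^ (g - 1)) ^+ l <= (k0%:R `^ (g - 1)) ^+ l :> R.
  rewrite lerXn2r ?nnegrE ?powR_ge0//.
  by apply: ge0_ler_powR; rewrite ?nnegrE ?ler0n// ler_nat.
have h3 : 2 <= 2 ^+ l :> R by rewrite ler_eXnr// ler1n.
have -> : 24 * K ^+ 2 * g `^ g * k0%:R `^ (g - 1) =
    3 * (2 * ((4 * K ^+ 2) * (g `^ g * k0%:R `^ (g - 1)))) by ring.
rewrite [X in _ <= _ * X]exprMn [in leRHS]mulrCA ler_wpM2l ?exprn_ge0//.
rewrite [X in _ <= _ * X]exprMn [X in _ <= _ * (_ * X)]exprMn.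
rewrite [in X in _ <= X]mulrA [in X in _ <= X]mulrA.
rewrite [X in _ <= _ * X]exprMn.
set G := (g `^ g) ^+ l; set K4 := (4 * K ^+ 2) ^+ l.
have G0 : 0 <= G by rewrite exprn_ge0// powR_ge0.
have K40 : 0 <= K4 by rewrite exprn_ge0// mulr_ge0// sqr_ge0.
have -> : (l.*2 ^_ l)%:R * 2 ^+ l * K4 * (G * (k0%:R `^ (g - 1)) ^+ l) =
  (2 ^+ l * K4) * (G * ((l.*2 ^_ l)%:R * (k0%:R `^ (g - 1)) ^+ l)) by ring.
apply: ler_pM.
- exact: mulr_ge0.
- by apply: mulr_ge0 => //; rewrite mulr_ge0 ?exprn_ge0 ?powR_ge0.
- exact: ler_wpM2r.
- apply: ler_wpM2l => //; apply: ler_pM => //.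
Qed.

End PsiMoments.

Section DeviationTail.
Variables (R : realType) (m n : nat) (d : measure_display).
Variables (Omega : measurableType d) (P : probability Omega R).
Variable A : Omega -> 'M[R]_(m, n).
Variables (alpha K : R).
Hypothesis mA : random_matrix A.
Hypothesis indA : independent_vectors P (fun i w => col i (A w)).
Hypothesis meanA : forall i j, ('E_P[fun w => A w j i] = 0)%E.
Hypothesis normA : forall i, {ae P, forall w, l2norm (col i (A w)) = 1}.
Hypothesis psiA : forall i,
  (psi_norm_vec P alpha (fun w => col i (A w)) <= K%:E)%E.
Hypothesis alpha0 : 0 < alpha.
Hypothesis alpha2 : alpha <= 2.
Hypothesis K0 : 0 < K.
Let g := 2 / alpha.

Let measurable_col_entry i j : measurable_fun setT (fun w => col i (A w) j 0).
Proof.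
rewrite (_ : (fun w => _) = (fun w => A w j i)); last first.
  by apply/funext => w; rewrite mxE.
exact: mA.
Qed.

(** The constant 24 k^(g-1) of [psi_moment_const_le] multiplied by 2k, since (2k)!/k! is at most
    (2k)^k. *)
Let b (k : nat) : R := 48 * K ^+ 2 * (g `^ g * k%:R `^ g).

Let g0 : 0 < g. Proof. by rewrite divr_gt0. Qed.

Let b_gt0 k : (0 < k)%N -> 0 < b k.
Proof.
by move=> k0; rewrite /b !mulr_gt0 ?exprn_gt0 ?powR_gt0 ?ltr0n.
Qed.

Let b_le k l : (k <= l)%N -> b k <= b l.
Proof.
move=> kl; rewrite /b ler_wpM2l ?mulr_ge0 ?exprn_ge0 ?(ltW K0)//.
rewrite ler_wpM2l ?powR_ge0//.
by apply: ge0_ler_powR; rewrite ?nnegrE ?ler0n ?(ltW g0)// ler_nat.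
Qed.

(** The free upper index [l] lets the moments of order k and 2k share one constant, as the increment
    bound requires. *)
Let decoupled k l (u v : 'cV[R]_n) : (0 < k)%N -> (k <= l)%N ->
  (forall i, u i 0 = 0 \/ v i 0 = 0) ->
  Ex P A (fun M => dotv (M *m u) (M *m v) ^+ k.*2) <=
  (b l * dotv u u) ^+ k * Ex P A (fun M => dotv (M *m v) (M *m v) ^+ k).
Proof.
move=> k0 kl uv.
pose theta := 24 * K ^+ 2 * g `^ g * k%:R `^ (g - 1).
have theta0 : 0 <= theta.
  by rewrite /theta !mulr_ge0 ?powR_ge0 ?exprn_ge0 ?(ltW K0).
have momA l' i v' := psi_norm_vec_moment_le alpha0 K0 l' v' (measurable_col_entry i) (psiA i).
have Hc l' (h : (l' <= k)%N) := psi_moment_const_le K alpha0 alpha2 h.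
have := decoupled_moment_le mA indA meanA normA momA theta0 Hc 0 (leqnn k) uv.
under eq_fun do rewrite expr0 mulr1; rewrite addn0 => /le_trans; apply.
rewrite ler_wpM2r//; first by apply: Ex_ge0 => M; rewrite exprn_ge0// dotvv_ge0.
have h1 : (k.*2 ^_ k)%:R <= (k.*2%:R) ^+ k :> R by rewrite -natrX ler_nat ffact_le_expn.
apply: (@le_trans _ _ ((k.*2%:R) ^+ k * (theta * dotv u u) ^+ k)).
  by rewrite ler_wpM2r// exprn_ge0// mulr_ge0// dotvv_ge0.
rewrite -exprMn lerXn2r ?nnegrE//.
- by apply: mulr_ge0 => //; apply: mulr_ge0 => //; exact: dotvv_ge0.
- by apply: mulr_ge0; [rewrite ltW// b_gt0// (leq_trans k0)|exact: dotvv_ge0].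
rewrite mulrA ler_wpM2r ?dotvv_ge0// (le_trans _ (b_le kl))//.
rewrite /b /theta -(@mulr_powRB1 _ k%:R g) ?ler0n// -mul2n natrM.
by rewrite le_eqVlt; apply/orP; left; apply/eqP; ring.
Qed.

Lemma deviation_psi_tail (x y : 'cV[R]_n) (j : nat) :
  (P [set w | (2 ^+ 14 * (8 / alpha) `^ alpha^-1 * K * 2 `^ (j%:R / alpha) *
       l2norm (x - y) < `|deviation (A w) x - deviation (A w) y|)%R] <=
   (expR (- (2 ^ j.+2)%:R))%:E)%E.
Proof.
pose k := (2 ^ j.+1)%N; have k0 : (0 < k)%N by rewrite expn_gt0.
have k20 : (0 < k.*2)%N by rewrite double_gt0.
have kk : (k <= k.*2)%N by rewrite -addnn leq_addr.
pose bb := b k.*2; have bb0 : 0 < bb by exact: b_gt0.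
have D1 u v := @decoupled k k.*2 u v k0 kk.
have D2 u v := @decoupled k.*2 k.*2 u v k20 (leqnn _).
have a0 : 0 < 16 * bb by rewrite mulr_gt0.
rewrite (_ : (2 ^ j.+2)%N = k.*2); last by rewrite /k expnS mul2n.
apply: (@deviation_increment_tail _ _ _ _ _ P A mA normA k (16 * bb) k0 a0).
- by move=> v; exact: norm_moment_le.
- by move=> u v; exact: gram_excess_moment_le.
- by move=> v; exact: norm_moment_le.
- by move=> u v; exact: gram_excess_moment_le.
(* Here k.*2 = 2^(j+2), so g * k.*2 = (8/alpha) * 2^j, which explains the base 8/alpha. Bounding e^2
   by 16, the numerical factor is 16 * 2^13 * 16 * 48 = 3 * 2^25, below 2^28, the square of 2^14. *)
- set c := (8 / alpha) `^ _; set p := 2 `^ _.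
  have cp : (c * p) ^+ 2 = g `^ g * k.*2%:R `^ g.
    rewrite /c /p powRrM powR_mulrn//.
    rewrite -powRM ?exprn_ge0 ?divr_ge0 ?(ltW alpha0)//.
    rewrite -[LHS]powR_mulrn ?powR_ge0// -powRrM -powRM ?ler0n ?(ltW g0)//.
    rewrite [LHS](_ : _ = (8 / alpha * 2 ^+ j) `^ g); last by rewrite [_^-1 * _]mulrC.
    congr (_ `^ _).
    rewrite /k -mul2n -expnS natrX !exprS /g; ring.
  have e2 : expR 1 ^+ 2 <= 16 :> R.
    have := expR1_le4 R; have := expR_ge0 (1 : R).
    by move: (expR 1) => e e0' e4; nra.
  have -> : (2 ^+ 14 * c * K * p) ^+ 2 = 2 ^+ 28 * (K ^+ 2 * (c * p) ^+ 2) by ring.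
  rewrite /bb /b -cp; set T := K ^+ 2 * (c * p) ^+ 2.
  have T0 : 0 <= T by rewrite mulr_ge0 ?sqr_ge0.
  apply: (@le_trans _ _ (16 * (2 ^+ 13 * (16 * (48 * T))))).
    rewrite (_ : 48 * K ^+ 2 * (c * p) ^+ 2 = 48 * T); last by rewrite /T mulrA.
    apply: ler_wpM2r => //; apply: mulr_ge0; first exact: exprn_ge0.
    by do 2 apply: mulr_ge0 => //.
  have -> : 16 * (2 ^+ 13 * (16 * (48 * T))) = 3 * 2 ^+ 25 * T by ring.
  rewrite ler_wpM2r// (_ : 2 ^+ 28 = 8 * 2 ^+ 25); last by ring.
  by rewrite ler_wpM2r ?exprn_ge0// ler_nat.
- by rewrite !mulr_ge0 ?powR_ge0 ?exprn_ge0 ?(ltW K0).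
Qed.

End DeviationTail.

(** * Generic chaining *)

Section AdmissibleSequences.
Variables (R : realType) (n : nat) (T : set 'cV[R]_n).
Variable Ak : nat -> set (set 'cV[R]_n).
Hypothesis admA : admissible T Ak.

Lemma pblock_admissible k t : T t ->
  Ak k (pblock (Ak k) id t) /\ pblock (Ak k) id t t.
Proof.
move=> Tt; rewrite /pblock /pblock_index.
have [partA _ _ _] := admA; have [coverA _ _] := partA k.
have [S AS St] : cover (Ak k) id t by rewrite coverA.
by apply: (@getPex _ (fun S => Ak k S /\ S t)); exists S.
Qed.

Lemma pblock_unique k S t : Ak k S -> S t -> pblock (Ak k) id t = S.
Proof.
move=> AS St; have [partA _ _ _] := admA; have [coverA trivA _] := partA k.
have Tt : T t by rewrite -coverA; exists S.
have [AS' St'] := pblock_admissible k Tt.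
by apply: trivA => //; exists t; split.
Qed.

Lemma pblock_sub k S t s : Ak k S -> S t -> S s ->
  pblock (Ak k) id s = pblock (Ak k) id t.
Proof. by move=> AS St Ss; rewrite (pblock_unique AS St) (pblock_unique AS Ss). Qed.

Lemma pblockS k t : T t ->
  pblock (Ak k.+1) id t `<=` pblock (Ak k) id t.
Proof.
move=> Tt; have [_ nestA _ _] := admA.
have [AS St] := pblock_admissible k.+1 Tt; have [S' AS' SS'] := nestA _ _ AS.
by rewrite (pblock_unique AS' (SS' _ St)).
Qed.

Lemma pblock_subT k t : T t -> pblock (Ak k) id t `<=` T.
Proof.
move=> Tt s Ss; have [partA _ _ _] := admA; have [<- _ _] := partA k.
by exists (pblock (Ak k) id t) => //; have [] := pblock_admissible k Tt.
Qed.

(** Numbering the blocks, with repetitions allowed, makes every union bound a finite union over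
    [i < 2 ^ 2 ^ k]. Level 0 fits as well, its single block being counted as at most two. *)
Lemma admissible_enum : exists g : nat -> nat -> set 'cV[R]_n,
  forall k S, Ak k S -> exists2 i, (i < 2 ^ 2 ^ k)%N & g k i = S.
Proof.
have cardA k : (Ak k #<= `I_(2 ^ 2 ^ k))%card.
  have [_ _ A0 A1] := admA; case: k => [|k]; last exact: A1.
  rewrite (card_le_eql A0).
  by apply: subset_card_le => -[].
have /choice[g gP] : forall k, exists f : nat -> set 'cV[R]_n,
    set_surj `I_(2 ^ 2 ^ k) (Ak k) f by move=> k; apply/pcard_surjP.
by exists g => k S /gP[i iN iS]; exists i.
Qed.

Definition block_rep (S : set 'cV[R]_n) : 'cV[R]_n := get S.

Lemma block_repP k t : T t -> pblock (Ak k) id t (block_rep (pblock (Ak k) id t)).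
Proof.
move=> Tt; have [_ St] := pblock_admissible k Tt.
by apply: (@getPex _ (pblock (Ak k) id t)); exists t.
Qed.

(** A link of the chain is thus determined by its finer block alone, so links are counted by the
    blocks of level [k.+1] and not by pairs of blocks. *)
Lemma block_rep_parent k t : T t ->
  pblock (Ak k) id (block_rep (pblock (Ak k.+1) id t)) = pblock (Ak k) id t.
Proof.
move=> Tt; have [AS St] := pblock_admissible k Tt.
by apply: (pblock_sub AS) => //; apply: pblockS => //; exact: block_repP.
Qed.

Lemma l2norm_le_diam (S : set 'cV[R]_n) s t : S s -> S t ->
  ((l2norm (s - t))%:E <= diam S)%E.
Proof. by move=> Ss St; apply: ereal_sup_ubound; exists s => //; exists t. Qed.

Lemma diam_pblock_ge0 k t : T t -> (0 <= diam (pblock (Ak k) id t))%E.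
Proof.
move=> Tt; have [_ St] := pblock_admissible k Tt.
by apply: le_trans (l2norm_le_diam St St); rewrite lee_fin l2norm_ge0.
Qed.

(** A single term of the bounded series forces the diameter at level N to be at most G /
    2^(N/alpha), which tends to 0. *)
Lemma block_rep_dense (alpha G : R) l t e :
  0 < alpha ->
  (forall t, T t -> (\sum_(0 <= k <oo)
      (2 `^ (k%:R / alpha))%:E * diam (pblock (Ak k) id t) <= G%:E)%E) ->
  T t -> 0 < e ->
  exists2 N, (l <= N)%N & l2norm (t - block_rep (pblock (Ak N) id t)) <= e.
Proof.
move=> alpha0 TG Tt e0; pose weight k : R := 2 `^ (k%:R / alpha).
have term0 k : (0 <= (weight k)%:E * diam (pblock (Ak k) id t))%E.
  by rewrite mule_ge0 ?lee_fin ?powR_ge0// diam_pblock_ge0.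
have l2 : 0 < ln (2 : R) by rewrite ln_gt0// ltr1n.
(* Chosen so that N >= q gives (N/alpha) ln 2 >= G/e, whence 2^(N/alpha) >= G/e by exp x >= 1 +
   x. *)
pose q := G / e * alpha / ln 2.
exists (maxn l (Num.truncn q).+1); first exact: leq_maxl.
set N := maxn _ _.
have qN : q <= N%:R.
  apply: (@le_trans _ _ (Num.truncn q).+1%:R).
    by rewrite ltW// truncnS_gt.
  by rewrite ler_nat leq_maxr.
have wN : 0 < weight N by rewrite powR_gt0.
have GN : G <= weight N * e.
  rewrite -ler_pdivrMr// /weight /powR (_ : 2 == 0 = false)//; last first.
    by apply/negbTE; rewrite pnatr_eq0.
  apply: le_trans (expR_ge1Dx _).
  apply: (@le_trans _ _ (N%:R / alpha * ln 2)); last lra.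
  have -> : G / e = q / alpha * ln 2 by rewrite /q; field; rewrite !gt_eqF.
  by rewrite ler_pM2r// ler_pM2r// invr_gt0.
rewrite -(ler_pM2l wN) (le_trans _ GN)//.
rewrite -lee_fin; apply: le_trans (TG t Tt).
apply: le_trans (nneseries_lim_ge N.+1 (fun k _ _ => term0 k)).
rewrite big_nat_recr//= -[leLHS]add0e leeD//; first by apply: sume_ge0 => k _; exact: term0.
rewrite EFinM lee_wpmul2l ?lee_fin ?powR_ge0//; apply: l2norm_le_diam.
  by have [] := pblock_admissible N Tt.
exact: block_repP.
Qed.

End AdmissibleSequences.

Section GenericChaining.
Variables (R : realType) (n : nat) (d : measure_display).
Variables (Omega : measurableType d) (P : probability Omega R).
Variable D : Omega -> 'cV[R]_n -> R.
Variables (alpha B : R).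
Hypothesis alpha0 : 0 < alpha.
Hypothesis B0 : 0 <= B.
Hypothesis mD : forall t, measurable_fun setT (D ^~ t).
Hypothesis D0 : forall w, D w 0 = 0.
Hypothesis lipD : forall w, exists2 L, 0 <= L &
  forall x y, `|D w x - D w y| <= L * l2norm (x - y).
Hypothesis tailD : forall x y j,
  (P [set w | (B * 2 `^ (j%:R / alpha) * l2norm (x - y) < `|D w x - D w y|)%R]
   <= (expR (- (2 ^ j.+2)%:R))%:E)%E.
Variables (T : set 'cV[R]_n) (Ak : nat -> set (set 'cV[R]_n)).
Hypothesis admA : admissible T Ak.
Variable g : nat -> nat -> set 'cV[R]_n.
Hypothesis gP : forall k S, Ak k S -> exists2 i, (i < 2 ^ 2 ^ k)%N & g k i = S.

Let weight j : R := 2 `^ (j%:R / alpha).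

Let large j x y := [set w | B * weight j * l2norm (x - y) < `|D w x - D w y|].

Let measurable_large j x y : measurable (large j x y).
Proof.
rewrite -[large _ _ _]setTI; apply: measurable_fun_ltr => //.
apply: measurableT_comp => //; exact: measurable_funB (mD x) (mD y).
Qed.

Let start_event l := \big[setU/set0]_(i < 2 ^ 2 ^ l) large l (block_rep (g l i)) 0.

(** Each link joins a representative at level [j.+1] to that of its parent block. The threshold is
    the level-j one, whose failure probability exp(-2^(j+2)) beats the 2^(2^(j+1)) links. *)
Let step_event j := \big[setU/set0]_(i < 2 ^ 2 ^ j.+1)
  large j (block_rep (g j.+1 i))
    (block_rep (pblock (Ak j) id (block_rep (g j.+1 i)))).

(* The chain starts at level [l]: the levels below it are skipped because the
   threshold [2 `^ (l / alpha)] already dominates their union bounds. *)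
Definition chaining_bad l := start_event l `|` \bigcup_i step_event (l + i).

Let measurable_start l : measurable (start_event l).
Proof. by apply: bigsetU_measurable => i _. Qed.

Let measurable_step j : measurable (step_event j).
Proof. by apply: bigsetU_measurable => i _. Qed.

Lemma measurable_chaining_bad l : measurable (chaining_bad l).
Proof. by apply: measurableU => //; exact: bigcupT_measurable. Qed.

Let expn2_le_expR k : ((2 ^ 2 ^ k)%:R : R) <= expR (2 ^ k)%:R.
Proof.
rewrite -[(2 ^ k)%:R]mulr1 expRM_natl natrX lerXn2r ?nnegrE ?expR_ge0//.
by apply: le_trans (expR_ge1Dx 1); lra.
Qed.

Let union_bound N (F : nat -> set Omega) (p : R) :
  (forall i, measurable (F i)) -> (forall i, (P (F i) <= p%:E)%E) ->
  (P (\big[setU/set0]_(i < N) F i) <= (N%:R * p)%:E)%E.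
Proof.
move=> mF Fp; apply: le_trans (Boole_inequality P _) _ => //.
apply: (@le_trans _ _ (\sum_(i < N) p%:E)%E); first by apply: lee_sum => i _; exact: Fp.
by rewrite sumEFin sumr_const card_ord mulr_natl.
Qed.

Let prob_start l : (P (start_event l) <= (expR (- (2 ^ l.+1)%:R))%:E)%E.
Proof.
apply: le_trans (union_bound _ (F := fun i => large l (block_rep (g l i)) 0) _ _) _ => //.
  by move=> i; exact: tailD.
rewrite lee_fin; apply: (@le_trans _ _ (expR (2 ^ l)%:R * expR (- (2 ^ l.+2)%:R))).
  by rewrite ler_wpM2r ?expR_ge0.
rewrite -expRD ler_expR !expnS !natrM.
by have : 0 <= (2 ^ l)%:R :> R by []; lra.
Qed.

Let prob_step j : (P (step_event j) <= (expR (- (2 ^ j.+1)%:R))%:E)%E.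
Proof.
apply: le_trans (union_bound _ (F := fun i => large j (block_rep (g j.+1 i))
    (block_rep (pblock (Ak j) id (block_rep (g j.+1 i))))) _ _) _ => //.
  by move=> i; exact: tailD.
rewrite lee_fin; apply: (@le_trans _ _ (expR (2 ^ j.+1)%:R * expR (- (2 ^ j.+2)%:R))).
  by rewrite ler_wpM2r ?expR_ge0.
rewrite -expRD ler_expR !expnS !natrM.
by have : 0 <= (2 ^ j)%:R :> R by []; lra.
Qed.

(** One unit pays for the start; the steps decay at least like 2^(-i) from the same bound and sum to
    two more. *)
Lemma prob_chaining_bad l :
  (P (chaining_bad l) <= (3 * expR (- (2 ^ l.+1)%:R))%:E)%E.
Proof.
set e := expR _.
have e0 : 0 <= e by exact: expR_ge0.
have mU : measurable (\bigcup_i step_event (l + i)) by exact: bigcupT_measurable.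
have hU : (P (chaining_bad l) <= P (start_event l) + P (\bigcup_i step_event (l + i)))%E.
  exact: measureU2.
apply: (le_trans hU).
rewrite (_ : 3 * e = e + 2 * e); last by ring.
rewrite EFinD leeD//.
have hB : (P (\bigcup_i step_event (l + i)) <=
    \sum_(0 <= i <oo) P (step_event (l + i)))%E.
  by apply: generalized_Boole_inequality => // i; exact: measurable_step.
apply: (le_trans hB).
have e20 : 0 <= 2 * e by rewrite mulr_ge0.
apply: le_trans (epsilon_trick0 xpredT e20).
apply: lee_nneseries => // i _; apply: le_trans (prob_step _) _.
rewrite lee_fin ler_pdivlMr ?ltr0n ?expn_gt0//.
rewrite (_ : (2 ^ i.+1)%:R = 2 * (2 ^ i)%:R); last by rewrite expnS natrM.
rewrite mulrCA ler_pM2l//.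
apply: (@le_trans _ _ (expR (- (2 ^ (l + i).+1)%:R) * expR i%:R)).
  rewrite ler_wpM2l ?expR_ge0//.
  rewrite -[i%:R]mulr1 expRM_natl natrX lerXn2r ?nnegrE ?expR_ge0//.
  by apply: le_trans (expR_ge1Dx 1); lra.
(* The doubly exponential decay leaves room for the extra exp(i), which majorizes 2^i. *)
have : (2 ^ l.+1 + i <= 2 ^ (l + i).+1)%N.
  rewrite -addSn expnD; have : (i < 2 ^ i)%N by exact: ltn_expl.
  have : (0 < 2 ^ l.+1)%N by rewrite expn_gt0.
  by nia.
rewrite /e -expRD ler_expR -(ler_nat R) natrD.
by lra.
Qed.

(** Telescoping from level [l], where the representative is compared with 0, and bounding each link
    by the diameter of the coarser block. The terms of the sum below [l] are nonnegative surplus. *)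
Let chain_sum w l N t : T t -> ~ chaining_bad l w -> (l <= N)%N ->
  ((`|D w (block_rep (pblock (Ak N) id t))|)%:E <=
   (B * weight l * l2norm (block_rep (pblock (Ak l) id t)))%:E +
   B%:E * \sum_(0 <= k < N) ((weight k)%:E * diam (pblock (Ak k) id t)))%E.
Proof.
move=> Tt nb; have [partA _ _ _] := admA.
have s0 M : (0 <= \sum_(0 <= k < M) ((weight k)%:E * diam (pblock (Ak k) id t)))%E.
  apply: sume_ge0 => k _; rewrite mule_ge0 ?lee_fin ?powR_ge0//.
  exact: (diam_pblock_ge0 admA).
elim: N => [|N IH].
  rewrite leqn0 => /eqP l0; rewrite l0 in nb *.
  have [AS _] := pblock_admissible admA 0 Tt; have [i iN gi] := gP AS.
  rewrite big_geq// mule0 adde0 lee_fin leNgt; apply/negP => h.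
  apply: nb; left; rewrite /start_event
    -(bigcup_mkord _ (fun i => large _ (block_rep (g _ i)) 0)); exists i => //.
  by rewrite /large /= gi D0 !subr0.
rewrite leq_eqVlt => /predU1P[lN|].
  rewrite lN in nb *.
  have [AS _] := pblock_admissible admA N.+1 Tt; have [i iN gi] := gP AS.
  rewrite -[leLHS]adde0 leeD//; last by rewrite mule_ge0// lee_fin.
  rewrite lee_fin leNgt; apply/negP => h.
  apply: nb; left; rewrite /start_event
    -(bigcup_mkord _ (fun i => large _ (block_rep (g _ i)) 0)); exists i => //.
  by rewrite /large /= gi D0 !subr0.
rewrite ltnS => lN; have {}IH := IH lN.
have [AS _] := pblock_admissible admA N.+1 Tt; have [i iN gi] := gP AS.
set x := block_rep (pblock (Ak N.+1) id t); set y := block_rep (pblock (Ak N) id t) in IH *.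
have xy : `|D w x - D w y| <= B * weight N * l2norm (x - y).
  rewrite leNgt; apply/negP => h; apply: nb; right; exists (N - l)%N => //.
  rewrite subnKC// /step_event
    -(bigcup_mkord _ (fun i => large N (block_rep (g N.+1 i))
    (block_rep (pblock (Ak N) id (block_rep (g N.+1 i)))))); exists i => //.
  by rewrite /large /= gi (block_rep_parent admA).
have xyd : ((l2norm (x - y))%:E <= diam (pblock (Ak N) id t))%E.
  apply: l2norm_le_diam; last exact: (block_repP admA).
  by apply: (pblockS admA Tt); exact: (block_repP admA).
rewrite big_nat_recr//= ge0_muleDr//; last first.
  by rewrite mule_ge0 ?lee_fin ?powR_ge0// (diam_pblock_ge0 admA).
rewrite addeA; apply: (@le_trans _ _ ((`|D w y|)%:E + (`|D w x - D w y|)%:E)%E).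
  by rewrite -EFinD lee_fin addrC -{1}(subrK (D w y) (D w x)) ler_normD.
apply: leeD => //.
apply: (@le_trans _ _ (B%:E * ((weight N)%:E * (l2norm (x - y))%:E))%E).
  by rewrite -!EFinM lee_fin mulrA.
by rewrite lee_wpmul2l ?lee_fin// lee_wpmul2l ?lee_fin ?powR_ge0.
Qed.

(** Chaining controls representatives only; the pathwise Lipschitz bound and [block_rep_dense] carry
    the estimate to every point. [L] may depend on [w], as it disappears with [e]. *)
Lemma chaining_good w l (G rho : R) : ~ chaining_bad l w ->
  (forall t, T t -> l2norm t <= rho) ->
  (forall t, T t -> (\sum_(0 <= k <oo)
      (weight k)%:E * diam (pblock (Ak k) id t) <= G%:E)%E) ->
  forall t, T t -> `|D w t| <= B * (G + weight l * rho).
Proof.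
move=> nb Trho TG t Tt.
have term0 k : (0 <= (weight k)%:E * diam (pblock (Ak k) id t))%E.
  by rewrite mule_ge0 ?lee_fin ?powR_ge0// (diam_pblock_ge0 admA).
have partial N : (\sum_(0 <= k < N) (weight k)%:E * diam (pblock (Ak k) id t) <= G%:E)%E.
  by apply: le_trans (TG t Tt); exact: nneseries_lim_ge.
have G0 : 0 <= G by have := partial 0%N; rewrite big_geq// lee_fin.
have [L L0 lipw] := lipD w.
apply/ler_addgt0Pr => e e0.
have eL : 0 < e / (L + 1) by rewrite divr_gt0// ltr_wpDl.
have [N lN hN] := block_rep_dense admA l alpha0 TG Tt eL.
set x := block_rep (pblock (Ak N) id t).
have xT : T x by apply: (pblock_subT admA Tt); exact: (block_repP admA).
have h1 : `|D w x| <= B * (G + weight l * rho).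
  have := chain_sum Tt nb lN; rewrite -/x => /le_trans h; rewrite -lee_fin; apply: h.
  apply: (@le_trans _ _ ((B * weight l * rho)%:E + B%:E * G%:E)%E).
    apply: leeD; last by rewrite lee_wpmul2l ?lee_fin.
    rewrite lee_fin ler_wpM2l ?mulr_ge0 ?powR_ge0// Trho//.
    by apply: (pblock_subT admA Tt); exact: (block_repP admA).
  by rewrite -EFinM -EFinD lee_fin mulrDr mulrA addrC.
have h2 : `|D w t - D w x| <= e.
  apply: le_trans (lipw _ _) _.
  apply: le_trans (ler_wpM2l L0 hN) _.
  by rewrite mulrA ler_pdivrMr ?ltr_wpDl// mulrC ler_wpM2l ?(ltW e0)// lerDl.
rewrite -(subrK (D w x) (D w t)) addrC (le_trans (ler_normD _ _))//.
by rewrite lerD.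
Qed.

End GenericChaining.

(** * The supremum of the deviation *)

Lemma l2norm_sum_le (R : realType) m (I : finType) (F : I -> 'cV[R]_m) :
  l2norm (\sum_i F i) <= \sum_i l2norm (F i).
Proof.
elim/big_ind2: _ => [|x a y b xa yb|//]; first by rewrite l2norm0.
by rewrite (le_trans (ler_l2normD _ _))// lerD.
Qed.

Lemma l2norm_mulmx_le (R : realType) m n (M : 'M[R]_(m, n)) (z : 'cV[R]_n) :
  l2norm (M *m z) <= (\sum_i l2norm (col i M)) * l2norm z.
Proof.
have -> : M *m z = \sum_i z i 0 *: col i M.
  apply/colP => j; rewrite mxE summxE; apply: eq_bigr => i _.
  by rewrite !mxE mulrC.
rewrite (le_trans (l2norm_sum_le _))// mulr_suml; apply: ler_sum => i _.
rewrite l2normZ mulrC ler_wpM2l ?l2norm_ge0//.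
rewrite -(ler_pXn2r (n := 2))// ?nnegrE ?l2norm_ge0//.
by rewrite real_normK ?num_real// sqr_l2norm sqr_entry_le.
Qed.

Lemma deviation_lipschitz (R : realType) m n (M : 'M[R]_(m, n)) :
  exists2 L, 0 <= L & forall x y : 'cV[R]_n,
    `|deviation M x - deviation M y| <= L * l2norm (x - y).
Proof.
exists (\sum_i l2norm (col i M) + 1).
  by rewrite addr_ge0// sumr_ge0// => i _; exact: l2norm_ge0.
move=> x y; rewrite (le_trans (deviation_increment_crude _ _ _))//.
by rewrite mulrDl mul1r lerD2r l2norm_mulmx_le.
Qed.

Section SupDeviation.
Variables (R : realType) (m n : nat) (d : measure_display).
Variables (Omega : measurableType d) (P : probability Omega R).
Variable A : Omega -> 'M[R]_(m, n).
Variables (alpha B : R).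
Hypothesis mA : random_matrix A.
Hypothesis alpha0 : 0 < alpha.
Hypothesis B0 : 0 < B.
Hypothesis tailA : forall x y j,
  (P [set w | (B * 2 `^ (j%:R / alpha) * l2norm (x - y) <
     `|deviation (A w) x - deviation (A w) y|)%R] <= (expR (- (2 ^ j.+2)%:R))%:E)%E.
Variables (T : set 'cV[R]_n) (Ak : nat -> set (set 'cV[R]_n)).
Hypothesis admA : admissible T Ak.
Variables (G rho : R).
Hypothesis T0 : T !=set0.
Hypothesis Trho : forall t, T t -> l2norm t <= rho.
Hypothesis rho0 : 0 < rho.
Hypothesis TG : forall t, T t -> (\sum_(0 <= k <oo)
  (2 `^ (k%:R / alpha))%:E * diam (pblock (Ak k) id t) <= G%:E)%E.

Let weight j : R := 2 `^ (j%:R / alpha).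

Let mD t : measurable_fun setT (fun w => deviation (A w) t).
Proof. exact: deviation_measurable. Qed.

(* [T] is replaced by the countable dense subset of block representatives. *)
Lemma measurable_sup_deviation :
  measurable_fun setT (fun w => sup_deviation (A w) T).
Proof.
have [g gP] := admissible_enum admA; have [t0 Tt0] := T0.
(* Undecodable numbers fall back to the pair (0, 0), and representatives outside [T] fall back to
   [t0], so [s] stays in [T]. *)
pose s p := let ki := odflt (0, 0)%N (unpickle p : option (nat * nat)) in
  let x := block_rep (g ki.1 ki.2) in if pselect (T x) then x else t0.
have sT p : T (s p) by rewrite /s; case: pselect.
rewrite (_ : (fun w => _) = (fun w => esups
    (fun p => (`|deviation (A w) (s p)|)%:E) 0%N)); last first.
  apply/funext => w; apply/eqP; rewrite eq_le; apply/andP; split; last first.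
    apply: le_ereal_sup => _ [p _ <-]; exists (s p) => //.
  apply: ge_ereal_sup => _ [t Tt <-]; apply/lee_addgt0Pr => e e0.
  have [L L0 lipw] := deviation_lipschitz (A w).
  have eL : 0 < e / (L + 1) by rewrite divr_gt0// ltr_wpDl.
  have [N _ hN] := block_rep_dense admA 0 alpha0 TG Tt eL.
  have [AS _] := pblock_admissible admA N Tt.
  have [i iN gi] := gP _ _ AS.
  set x := block_rep _ in hN.
  have Tx : T x by apply: (pblock_subT admA Tt); exact: (block_repP admA).
  have sx : s (pickle (N, i)) = x.
    by rewrite /s pickleK /= gi -/x; case: pselect.
  apply: (@le_trans _ _ ((`|deviation (A w) x|)%:E + e%:E)%E); last first.
    rewrite leeD2r//; apply: ereal_sup_ubound; exists (pickle (N, i)) => //.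
    by rewrite sx.
  rewrite -EFinD lee_fin -/(deviation (A w) t).
  rewrite -(subrK (deviation (A w) x) (deviation (A w) t)) addrC.
  rewrite (le_trans (ler_normD _ _))// lerD2l.
  apply: le_trans (lipw _ _) _; apply: le_trans (ler_wpM2l L0 hN) _.
  by rewrite mulrA ler_pdivrMr ?ltr_wpDl// mulrC ler_wpM2l ?(ltW e0)// lerDl.
apply: measurable_fun_esups => p; apply/measurable_EFinP.
exact: measurableT_comp (mD (s p)).
Qed.

Lemma sup_deviation_ge0 w : (0 <= sup_deviation (A w) T)%E.
Proof.
have [t Tt] := T0; apply: (@le_trans _ _ (`|deviation (A w) t|)%:E).
  by rewrite lee_fin.
by apply: ereal_sup_ubound; exists t.
Qed.

Let sup_deviation_le (g : nat -> nat -> set 'cV[R]_n)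
  (gP : forall k S, Ak k S -> exists2 i, (i < 2 ^ 2 ^ k)%N & g k i = S) w l :
  ~ chaining_bad (fun w => deviation (A w)) alpha B Ak g l w ->
  (sup_deviation (A w) T <= (B * (G + weight l * rho))%:E)%E.
Proof.
move=> nb; apply: ge_ereal_sup => _ [t Tt <-]; rewrite lee_fin.
have lip w' := deviation_lipschitz (A w').
exact: (chaining_good alpha0 (ltW B0) (fun w => deviation0 (A w)) lip admA gP nb).
Qed.

Lemma sup_deviation_tail l :
  ((1 - 3 * expR (- (2 ^ l.+1)%:R))%:E <=
    P [set w | (sup_deviation (A w) T <= (B * (G + weight l * rho))%:E)%E])%E.
Proof.
have [g gP] := admissible_enum admA.
pose bad := chaining_bad (fun w => deviation (A w)) alpha B Ak g l.
have mbad : measurable bad by exact: measurable_chaining_bad.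
have mS : measurable
    [set w | (sup_deviation (A w) T <= (B * (G + weight l * rho))%:E)%E].
  rewrite -[X in measurable X]setTI.
  exact: emeasurable_fun_infty_c measurable_sup_deviation _.
apply: (@le_trans _ _ (P (~` bad))); last first.
  apply: le_measure; rewrite ?inE//; first exact: measurableC.
  by move=> w nb; exact: (sup_deviation_le gP nb).
rewrite probability_setC// EFinB leeB//.
exact: (prob_chaining_bad alpha0 (ltW B0) mD tailA Ak g l).
Qed.

Let q := alpha^-1.

(** With y = 2^(l+1) and q = 1/alpha the weight is y^q. Spending one more power of y in
    [powR_le_expR] yields the factor 1/y, which makes these integrals summable in [l]. *)
Let integral_bad_le (g : nat -> nat -> set 'cV[R]_n) l :
  (\int[P]_w ((weight l.+1)%:E *
     (\1_(chaining_bad (fun w => deviation (A w)) alpha B Ak g l) w)%:E) <=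
   (3 * (q + 1) `^ (q + 1) / (2 ^ l.+1)%:R)%:E)%E.
Proof.
set bad := chaining_bad _ _ _ _ _ _.
have mbad : measurable bad by exact: measurable_chaining_bad.
have w0 : 0 <= weight l.+1 by exact: powR_ge0.
rewrite ge0_integralZl//; last first.
- by apply/measurable_EFinP; exact: measurable_indic.
rewrite integral_indic// setIT.
apply: le_trans (lee_wpmul2l _ (prob_chaining_bad alpha0 (ltW B0) mD tailA Ak g l)) _.
  by rewrite lee_fin.
rewrite -EFinM lee_fin; set y : R := (2 ^ l.+1)%:R.
have y0 : 0 < y by rewrite ltr0n expn_gt0.
have -> : weight l.+1 = y `^ q.
  by rewrite /weight /y /q powRrM powR_mulrn// natrX.
have q0 : 0 < q by rewrite invr_gt0.
have h : y * y `^ q <= (q + 1) `^ (q + 1) * expR y.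
  have -> : y * y `^ q = y `^ (q + 1).
    by rewrite -(@mulr_powRB1 _ y (q + 1)) ?ltW// ?addr_gt0// addrK.
  by apply: powR_le_expR; rewrite ?addr_gt0// ltW.
rewrite ler_pdivlMr// expRN.
have e0 : 0 < expR y by exact: expR_gt0.
rewrite -(ler_pM2r e0).
have -> : y `^ q * (3 * (expR y)^-1) * y * expR y = 3 * (y * y `^ q).
  by field; rewrite gt_eqF.
by rewrite -mulrA ler_pM2l.
Qed.

(** Pointwise, let l be the first level at which chaining succeeds. If l is positive then level l -
    1 is bad, so the weight of level l already occurs in the series of weighted indicators [h];
    integrating that series termwise gives the bound. *)
Lemma integral_sup_deviation_le :
  (\int[P]_w sup_deviation (A w) T <=
   (B * (G + rho) + B * rho * (3 * (q + 1) `^ (q + 1)))%:E)%E.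
Proof.
have [g gP] := admissible_enum admA.
pose bad l := chaining_bad (fun w => deviation (A w)) alpha B Ak g l.
have mbad l : measurable (bad l) by exact: measurable_chaining_bad.
pose h l w := ((weight l.+1)%:E * (\1_(bad l) w)%:E)%E.
have w0 l : 0 <= weight l by exact: powR_ge0.
have h0 l w : (0 <= h l w)%E by rewrite mule_ge0 ?lee_fin.
have mh l : measurable_fun setT (h l).
  by apply: measurable_funeM; apply/measurable_EFinP; exact: measurable_indic.
have BR : 0 < B * rho by rewrite mulr_gt0.
have G0 : 0 <= G.
  have [t Tt] := T0; rewrite -lee_fin; apply: le_trans (TG Tt).
  apply: nneseries_ge0 => k _ _; rewrite mule_ge0 ?lee_fin//.
  exact: (diam_pblock_ge0 admA).
have c0 : 0 <= B * (G + rho).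
  by rewrite mulr_ge0 ?addr_ge0// ltW.
have msum : measurable_fun setT (fun w => \sum_(0 <= l <oo) h l w)%E.
  by apply: ge0_emeasurable_sum.
have sum0 w : (0 <= \sum_(0 <= l <oo) h l w)%E by exact: nneseries_ge0.
have bound w : (sup_deviation (A w) T <=
    (B * (G + rho))%:E + (B * rho)%:E * \sum_(0 <= l <oo) h l w)%E.
  have [[l0 nl0]|allbad] := pselect (exists l, ~ bad l w).
    have [l nl lmin] := @ex_minnP (fun l => `[< ~ bad l w >]) (ex_intro _ l0 (asboolT nl0)).
    move/asboolP in nl; apply: le_trans (sup_deviation_le gP nl) _.
    case: l nl lmin => [|l] nl lmin.
      rewrite /weight mul0r powRr0 mul1r -[leLHS]adde0 leeD// mule_ge0//.
      by rewrite lee_fin ltW.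
    have bl : bad l w.
      apply: contrapT => nbl; have := lmin l (asboolT nbl).
      by rewrite ltnn.
    apply: (@le_trans _ _ ((B * (G + rho))%:E + (B * rho)%:E * h l w)%E).
      rewrite /h indicE mem_set// mule1 -EFinM -EFinD lee_fin.
      by rewrite mulrDr mulrDr [weight _ * _]mulrC mulrA lerD2r lerDl mulr_ge0// ltW.
    rewrite leeD2l// lee_wpmul2l ?lee_fin ?(ltW BR)//.
    apply: le_trans (nneseries_lim_ge l.+1 _) => //.
    by rewrite big_nat_recr//= -[leLHS]add0e leeD// sume_ge0.
  have all l : bad l w by apply: contrapT => nbl; apply: allbad; exists l.
  (* Where every level is bad, infinitely many weights, each at least 1, are counted, and the bound
     holds trivially. *)
  have -> : (\sum_(0 <= l <oo) h l w = +oo)%E.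
    apply: eq_infty => r; apply: (@le_trans _ _ ((Num.truncn `|r|).+1%:R)%:E).
      by rewrite lee_fin (le_trans (ler_norm _))// ltW// truncnS_gt.
    apply: le_trans (nneseries_lim_ge (Num.truncn `|r|).+1 _) => //.
    set N := (Num.truncn _).+1; have -> : (N%:R%:E = \sum_(0 <= l < N) 1 :> \bar R)%E.
      by rewrite sumEFin big_const_nat subn0 iter_addr_0.
    apply: lee_sum => l _; rewrite /h indicE mem_set ?mule1 ?lee_fin//.
    rewrite /weight -[leLHS](powRr0 2) ler_powR ?ler1n//.
    by rewrite divr_ge0// ltW.
  by rewrite gt0_muley ?lte_fin// addey// leey.
apply: (@le_trans _ _ (\int[P]_w ((B * (G + rho))%:E +
    (B * rho)%:E * \sum_(0 <= l <oo) h l w))%E).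
  apply: ge0_le_integral => //.
  - by move=> w _; exact: sup_deviation_ge0.
  - exact: measurable_sup_deviation.
  - by apply: emeasurable_funD => //; exact: measurable_funeM.
rewrite ge0_integralD//; last 2 first.
- by move=> w _; rewrite mule_ge0// lee_fin ltW.
- exact: measurable_funeM.
rewrite EFinD leeD//.
  rewrite integral_cst// -[leRHS]mule1 lee_wpmul2l ?lee_fin//.
  exact: (probability_le1 P).
rewrite ge0_integralZl//; last by rewrite lee_fin ltW.
rewrite [leRHS]EFinM lee_wpmul2l ?lee_fin ?(ltW BR)//.
rewrite integral_nneseries//.
have s0 : 0 <= 3 * (q + 1) `^ (q + 1) by rewrite mulr_ge0 ?powR_ge0.
apply: le_trans (epsilon_trick0 xpredT s0).
apply: lee_nneseries => l; first by move=> _ _; apply: integral_ge0.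
by move=> _; exact: integral_bad_le.
Qed.

End SupDeviation.

(** * Finiteness and degenerate values of the radius and of gamma *)

Section SetFunctionals.
Variables (R : realType) (n : nat) (T : set 'cV[R]_n).

(** [bounded_set] refers to the sup norm. The crude factor [n] suffices, since only finiteness of
    the radius is drawn from it. *)
Lemma l2norm_le_mx_norm (x : 'cV[R]_n) : l2norm x <= n%:R * `|x|.
Proof.
have xE : x = \sum_i x i 0 *: delta_mx i 0.
  apply/colP => j; rewrite summxE (bigD1 j)//= big1 => [|i ij].
    by rewrite !mxE !eqxx mulr1 addr0.
  by rewrite !mxE eq_sym (negbTE ij) mulr0.
rewrite {1}xE (le_trans (l2norm_sum_le _))//.
rewrite -[n in n%:R]card_ord mulr_natl -sumr_const; apply: ler_sum => i _.
rewrite l2normZ.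
have -> : l2norm (delta_mx i 0 : 'cV[R]_n) = 1.
  by rewrite /l2norm dotv_delta mxE !eqxx sqrtr1.
rewrite mulr1 [leRHS]/Num.norm /= mx_normrE; apply/bigmax_geP; right => /=.
by exists (i, 0).
Qed.

Lemma bounded_l2rad : bounded_set T -> T !=set0 ->
  exists2 rho, 0 <= rho & l2rad T = rho%:E.
Proof.
move=> [M [_ TM]] [t0 Tt0].
have ub : (l2rad T <= (n%:R * (M + 1))%:E)%E.
  apply: ge_ereal_sup => _ [t Tt <-]; rewrite lee_fin.
  by rewrite (le_trans (l2norm_le_mx_norm _))// ler_wpM2l//; apply: TM => //; rewrite ltrDl.
have lb : (0 <= l2rad T)%E.
  apply: (@le_trans _ _ (l2norm t0)%:E); first by rewrite lee_fin l2norm_ge0.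
  by apply: ereal_sup_ubound; exists t0.
exists (fine (l2rad T)); first by rewrite fine_ge0.
by rewrite fineK// ge0_fin_numE// (le_lt_trans ub)// ltry.
Qed.

Lemma l2norm_le_l2rad rho t : l2rad T = rho%:E -> T t -> l2norm t <= rho.
Proof.
by move=> Trho Tt; rewrite -lee_fin -Trho; apply: ereal_sup_ubound; exists t.
Qed.

Lemma gamma_ge0 (alpha : R) : T !=set0 -> (0 <= gamma alpha T)%E.
Proof.
move=> [t Tt]; apply/ereal_infP => _ [Ak admA <-].
apply: (@le_trans _ _ (\sum_(0 <= k <oo)
    (2 `^ (k%:R / alpha))%:E * diam (pblock (Ak k) id t))%E).
  apply: nneseries_ge0 => k _ _; rewrite mule_ge0 ?lee_fin ?powR_ge0//.
  exact: (diam_pblock_ge0 admA).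
by apply: ereal_sup_ubound; exists t.
Qed.

Lemma gamma_singleton (alpha : R) : T = [set 0] -> gamma alpha T = 0%E.
Proof.
move=> TE; apply/eqP; rewrite eq_le gamma_ge0 ?andbT; last by exists 0; rewrite TE.
pose Ak (k : nat) : set (set 'cV[R]_n) := [set T].
have admA : admissible T Ak.
  split.
  - move=> k; split.
    + by rewrite /Ak /cover bigcup_set1.
    + by move=> _ _ -> ->.
    + by move=> _ ->; exists 0; rewrite TE.
  - by move=> k _ ->; exists T.
  - exact: card_set1.
  - move=> k _; apply: (@card_le_trans _ _ _ `I_1).
      by have /card_eqPle[] := @card_set1 _ T.
    by apply: subset_card_le => i /=; rewrite ltnS leqn0 => /eqP ->; rewrite expn_gt0.
apply: ge_ereal_inf; exists (ereal_sup [set (\sum_(0 <= k <oo)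
    (2 `^ (k%:R / alpha))%:E * diam (pblock (Ak k) id t))%E | t in T]).
  by exists Ak.
apply: ge_ereal_sup => _ [t Tt <-]; rewrite eseries0// => k _ _.
have [-> _] := pblock_admissible admA k Tt.
suff -> : diam T = 0%E by rewrite mule0.
rewrite /diam TE; apply/eqP; rewrite eq_le; apply/andP; split.
  by apply: ge_ereal_sup => _ [s -> [s' -> <-]]; rewrite subr0 l2norm0.
by apply: ereal_sup_ubound; exists 0 => //; exists 0 => //; rewrite subr0 l2norm0.
Qed.

End SetFunctionals.

(** A unit column cannot have vanishing psi_alpha norm: for [K <= 0] every entry would have an
    arbitrarily small second moment, while these moments sum to 1. *)
Lemma psi_bound_gt0 (R : realType) (m n : nat) (d : measure_display)
    (Omega : measurableType d) (P : probability Omega R)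
    (A : Omega -> 'M[R]_(m, n)) (alpha K : R) (i : 'I_n) :
  0 < alpha -> random_matrix A ->
  (forall i, {ae P, forall w, l2norm (col i (A w)) = 1}) ->
  (psi_norm_vec P alpha (fun w => col i (A w)) <= K%:E)%E -> 0 < K.
Proof.
move=> alpha0 mA normA psiA; rewrite ltNge; apply/negP => K0.
pose c : R := 2 * (1%:R * (2 / alpha)) `^ (1%:R * (2 / alpha)).
have c0 : 0 <= c by rewrite mulr_ge0 ?powR_ge0.
(* Large enough that the [m] second moments, each at most c / N^2, add up to less than 1. *)
pose N : R := m%:R * c + 1.
have N1 : 1 <= N by rewrite /N lerDr mulr_ge0.
have N0 : 0 < N by apply: lt_le_trans N1.
have small j : Ex P A (fun M => M j i ^+ 2) <= c * (N^-1) ^+ 2.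
  have tj : tame (fun M : 'M[R]_(m, n) => M j i ^+ 2).
    by apply: tameX; exact: tame_entry.
  pose X w : R := dotv (col i (A w)) (delta_mx j 0).
  have mj : measurable_fun setT X.
    by rewrite /X; under eq_fun do rewrite dotv_delta mxE; exact: mA.
  have psij : (psi_norm P alpha X < (N^-1)%:E)%E.
    apply: (@le_lt_trans _ _ K%:E); last by rewrite lte_fin (le_lt_trans K0)// invr_gt0.
    apply: le_trans psiA; apply: ereal_sup_ubound; exists (delta_mx j 0) => //.
    by rewrite /unit_sphere /= /l2norm dotv_delta mxE !eqxx sqrtr1.
  have := psi_norm_moment_le alpha0 mj (ltn0Sn 0) psij; rewrite /X.
  under eq_integral do rewrite dotv_delta mxE.
  rewrite -(EFin_Ex mA normA tj) lee_fin => /le_trans; apply.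
  by rewrite /c le_eqVlt; apply/orP; left; apply/eqP; rewrite mulrAC.
have : 1 <= m%:R * (c * (N^-1) ^+ 2).
  rewrite -[leLHS](Ex_cst P A 1).
  apply: (@le_trans _ _ (Ex P A (fun M => \sum_j M j i ^+ 2))).
    apply: (Ex_le mA normA); first exact: tame_cst.
      by apply: tame_sum => j; apply: tameX; exact: tame_entry.
    move=> M uM; rewrite -(expr1n R 2) -(uM i) sqr_l2norm /dotv.
    by apply: ler_sum => j _; rewrite !mxE expr2.
  rewrite (Ex_sum mA normA) => [|j]; last by apply: tameX; exact: tame_entry.
  by rewrite -[m in m%:R]card_ord mulr_natl -sumr_const; exact: ler_sum.
have h : m%:R * c < N by rewrite /N ltrDl.
rewrite mulrA exprVn ler_pdivlMr ?exprn_gt0// mul1r.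
have : N <= N ^+ 2 by rewrite expr2 ler_peMr// ltW.
by lra.
Qed.

(** The increment constant of [deviation_psi_tail] without [K], times 2 + S. The 2 collects the
    radius term of chaining and the slack of a near-optimal admissible sequence; S is the series of
    [integral_sup_deviation_le]. *)
Definition chaining_const (R : realType) (alpha : R) : R :=
  2 ^+ 14 * (8 / alpha) `^ alpha^-1 *
  (2 + 3 * (alpha^-1 + 1) `^ (alpha^-1 + 1)).

Lemma chaining_const_gt0 (R : realType) (alpha : R) : 0 < alpha ->
  0 < chaining_const alpha.
Proof.
move=> alpha0; rewrite /chaining_const !mulr_gt0 ?exprn_gt0 ?powR_gt0 ?divr_gt0//.
by rewrite ltr_wpDr// mulr_ge0 ?powR_ge0.
Qed.

(** * The two bounds for a nonempty set of positive radius *)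

Section MainCase.
Variables (R : realType) (m n : nat) (d : measure_display).
Variables (Omega : measurableType d) (P : probability Omega R).
Variable A : Omega -> 'M[R]_(m, n).
Variables (alpha K : R) (T : set 'cV[R]_n).
Hypothesis alpha0 : 0 < alpha.
Hypothesis alpha2 : alpha <= 2.
Hypothesis mA : random_matrix A.
Hypothesis indA : independent_vectors P (fun i w => col i (A w)).
Hypothesis meanA : forall i j, ('E_P[fun w => A w j i] = 0)%E.
Hypothesis normA : forall i, {ae P, forall w, l2norm (col i (A w)) = 1}.
Hypothesis psiA : forall i,
  (psi_norm_vec P alpha (fun w => col i (A w)) <= K%:E)%E.
Hypothesis K0 : 0 < K.
Hypothesis T0 : T !=set0.
Variable rho : R.
Hypothesis rho0 : 0 < rho.
Hypothesis radT : l2rad T = rho%:E.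
Let C := chaining_const alpha.
Let B := 2 ^+ 14 * (8 / alpha) `^ alpha^-1 * K.
Let S := 3 * (alpha^-1 + 1) `^ (alpha^-1 + 1).

Let B0 : 0 < B.
Proof. by rewrite !mulr_gt0 ?exprn_gt0 ?powR_gt0 ?divr_gt0. Qed.

Let S0 : 0 <= S.
Proof. by rewrite mulr_ge0 ?powR_ge0. Qed.

Let CK : C * K = B * (2 + S).
Proof. by rewrite /C /chaining_const /B -/S mulrAC. Qed.

Let tailA x y j := deviation_psi_tail mA indA meanA normA psiA alpha0 alpha2 K0 x y j.

(* As the bounds allow an extra [l2rad], an admissible sequence within
   [l2rad] of the infimum defining [gamma] is good enough. *)
Let near_optimal (gam : R) : gamma alpha T = gam%:E ->
  exists2 Ak, admissible T Ak & forall t, T t -> (\sum_(0 <= k <oo)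
    (2 `^ (k%:R / alpha))%:E * diam (pblock (Ak k) id t) <= (gam + rho)%:E)%E.
Proof.
move=> gamE; have : (gamma alpha T < (gam + rho)%:E)%E.
  by rewrite gamE lte_fin ltrDl.
move=> /ereal_inf_lt[_ [Ak admA <-] lt]; exists Ak => // t Tt.
by apply: le_trans (ltW lt); apply: ereal_sup_ubound; exists t.
Qed.

Lemma expectation_bound_main :
  (\int[P]_w sup_deviation (A w) T <= (C * K)%:E * (gamma alpha T + l2rad T))%E.
Proof.
have CK0 : 0 < C * K by rewrite mulr_gt0// chaining_const_gt0.
have := gamma_ge0 alpha T0; case gamE : (gamma alpha T) => [gam| |]// gam0; last first.
  by rewrite radT addye// gt0_muley ?lte_fin// leey.
rewrite lee_fin in gam0.
have [Ak admA TG] := near_optimal gamE.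
have Trho t := @l2norm_le_l2rad _ _ _ rho t radT.
apply: le_trans (integral_sup_deviation_le mA alpha0 B0 tailA admA T0 Trho rho0 TG) _.
rewrite radT -EFinD -EFinM lee_fin CK -/S.
rewrite (_ : _ + _ = B * (gam + rho + rho + rho * S)); last by ring.
have gS : 0 <= gam * S by exact: mulr_ge0.
by rewrite -[leRHS]mulrA ler_pM2l//; lra.
Qed.

Lemma tail_bound_main (u : R) : 0 <= u ->
  ((1 - 4 * expR (- (u `^ alpha)))%:E <=
     P [set w | sup_deviation (A w) T
                  <= (C * K)%:E * (gamma alpha T + u%:E * l2rad T)])%E.
Proof.
move=> u0; have CK0 : 0 < C * K by rewrite mulr_gt0// chaining_const_gt0.
have p1 : 1 `^ alpha = 1 by rewrite powR1.
(* For small [u] the claim is void, because 4/e is at least 1. For [u >= 1] the slack [rho] is at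
   most [u * rho]. *)
have [u1|u1] := ltP u 1.
  apply: (@le_trans _ _ 0%E); last exact: measure_ge0.
  rewrite lee_fin subr_le0.
  have ua : u `^ alpha <= 1.
    rewrite -[leRHS]p1; apply: ge0_ler_powR; rewrite ?nnegrE// ltW//.
  apply: (@le_trans _ _ (4 * expR (- 1))); last first.
    by rewrite ler_wpM2l// ler_expR lerN2.
  by rewrite expRN ler_pdivlMr ?expR_gt0// mul1r expR1_le4.
have := gamma_ge0 alpha T0; case gamE : (gamma alpha T) => [gam| |]// gam0; last first.
  rewrite radT addye//.
  rewrite gt0_muley ?lte_fin// (_ : [set w | _] = setT); last first.
    by apply/seteqP; split => w //= _; exact: leey.
  by rewrite probability_setT lee_fin gerBl mulr_ge0// expR_ge0.
rewrite lee_fin in gam0.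
have [Ak admA TG] := near_optimal gamE.
have Trho t := @l2norm_le_l2rad _ _ _ rho t radT.
have ua1 : 1 <= u `^ alpha.
  by rewrite -[leLHS]p1; apply: ge0_ler_powR; rewrite ?nnegrE ?(ltW alpha0).
(* The level is the largest l with 2^l <= u^alpha: its weight is then at most [u], while u^alpha <=
   2^(l+1) makes its failure probability at most 3 exp(-u^alpha). *)
have /andP[t1 t2] := truncn_itv (le_trans ler01 ua1).
set N := Num.truncn (u `^ alpha) in t1 t2.
have N0 : (0 < N)%N.
  by rewrite lt0n; apply/eqP => NE; move: t2; rewrite NE ltNge ua1.
have /andP[l1 l2] := trunc_log_bounds (isT : (1 < 2)%N) N0.
set l := trunc_log 2 N in l1 l2.
have wu : 2 `^ (l%:R / alpha) <= u.
  have -> : u = (u `^ alpha) `^ alpha^-1 by rewrite -powRrM divff ?powRr1// gt_eqF.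
  rewrite powRrM powR_mulrn//; apply: ge0_ler_powR.
  - by rewrite invr_ge0 ltW.
  - by rewrite nnegrE exprn_ge0.
  - by rewrite nnegrE powR_ge0.
  - by rewrite -natrX (le_trans _ t1)// ler_nat.
have ul : u `^ alpha <= (2 ^ l.+1)%:R.
  by rewrite (le_trans (ltW t2))// ler_nat.
have tail := sup_deviation_tail mA alpha0 B0 tailA admA T0 Trho TG l.
apply: (@le_trans _ _ (1 - 3 * expR (- (2 ^ l.+1)%:R))%:E).
  rewrite lee_fin lerD2l lerN2.
  apply: (@le_trans _ _ (3 * expR (- u `^ alpha))).
    by rewrite ler_wpM2l// ler_expR lerN2.
  by rewrite ler_wpM2r ?expR_ge0// ler_nat.
apply: (le_trans tail); apply: le_measure; rewrite ?inE.
- rewrite -[X in measurable X]setTI; apply: emeasurable_fun_infty_c => //.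
  exact: (measurable_sup_deviation mA alpha0 admA T0 TG).
- rewrite -[X in measurable X]setTI; apply: emeasurable_fun_infty_c => //.
  exact: (measurable_sup_deviation mA alpha0 admA T0 TG).
move=> w /= /le_trans; apply.
rewrite radT -(EFinM u rho) -(EFinD gam) -(EFinM (C * K)) lee_fin CK -[leRHS]mulrA ler_pM2l//.
have wr : 2 `^ (l%:R / alpha) * rho <= u * rho by rewrite ler_wpM2r// ltW.
have ur : rho <= u * rho by rewrite ler_peMl// ltW.
rewrite mulrDl -[leLHS]addr0 lerD//; last first.
  by apply: mulr_ge0 => //; rewrite addr_ge0// mulr_ge0// ltW.
rewrite -addrA mulrDr; apply: lerD; first by rewrite ler_peMl// ler1n.
by rewrite [leRHS]mulr_natl mulr2n; exact: lerD.
Qed.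

End MainCase.

Section DegenerateCases.
Variables (R : realType) (m n : nat) (d : measure_display).
Variables (Omega : measurableType d) (P : probability Omega R).
Variable A : Omega -> 'M[R]_(m, n).

Lemma sup_deviation_set0 (M : 'M[R]_(m, n)) : sup_deviation M set0 = -oo%E.
Proof. by rewrite /sup_deviation image_set0 ereal_sup0. Qed.

Lemma sup_deviation_singleton0 (M : 'M[R]_(m, n)) :
  sup_deviation M [set 0] = 0%E.
Proof.
by rewrite /sup_deviation image_set1 ereal_sup1 mulmx0 !l2norm0 subrr normr0.
Qed.

Lemma sure_event_bound (C u alpha : R) (S : set Omega) : 0 <= C -> S = setT ->
  ((1 - C * expR (- (u `^ alpha)))%:E <= P S)%E.
Proof.
move=> C0 ->; rewrite probability_setT lee_fin gerBl mulr_ge0// expR_ge0.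
Qed.

Lemma l2rad_eq0 (T : set 'cV[R]_n) : T !=set0 -> l2rad T = 0%E -> T = [set 0].
Proof.
move=> [t0 Tt0] rad0; have T0 t : T t -> t = 0.
  move=> Tt; apply: l2norm_eq0; apply/eqP; rewrite eq_le l2norm_ge0 andbT.
  exact: (l2norm_le_l2rad rad0).
by apply/seteqP; split => t /=; [exact: T0|move=> ->; rewrite -(T0 _ Tt0)].
Qed.

End DegenerateCases.

Theorem theorem1p2 (R : realType) :
  exists C : R, 0 < C /\
  forall alpha : R, 0 < alpha -> alpha <= 2 ->
  exists Calpha : R, 0 < Calpha /\
  forall (d : measure_display) (Omega : measurableType d)
    (P : probability Omega R) (m n : nat) (A : Omega -> 'M[R]_(m, n))
    (K : R) (T : set 'cV[R]_n),
  random_matrix A ->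
  independent_vectors P (fun i w => col i (A w)) ->
  (forall i j, ('E_P[fun w => A w j i] = 0)%E) ->
  (forall i, {ae P, forall w, l2norm (col i (A w)) = 1}) ->
  (forall i, (psi_norm_vec P alpha (fun w => col i (A w)) <= K%:E)%E) ->
  bounded_set T ->
  (\int[P]_w sup_deviation (A w) T
     <= (Calpha * K)%:E * (gamma alpha T + l2rad T))%E /\
  (forall u : R, 0 <= u ->
    ((1 - C * expR (- (u `^ alpha)))%:E <=
       P [set w | sup_deviation (A w) T
                    <= (Calpha * K)%:E * (gamma alpha T + u%:E * l2rad T)])%E).
Proof.
(* The failure bound alone gives 3; the value 4 also covers [u < 1] through [expR1_le4]. *)
exists 4; split => // alpha alpha0 alpha2.
exists (chaining_const alpha); split; first exact: chaining_const_gt0.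
move=> d Omega P m n A K T mA indA meanA normA psiA bT.
(* The supremum over the empty set is -oo, so both bounds hold at once. *)
have [->|/set0P T0] := eqVneq T set0.
  under eq_integral do rewrite sup_deviation_set0.
  split=> [|u _].
    rewrite integral_cst// gt0_mulNye ?leNye//.
    have P1 : (0 < P setT)%E by rewrite probability_setT lte01.
    exact: P1.
  apply: sure_event_bound => //; apply/seteqP; split => w //= _.
  by rewrite sup_deviation_set0 leNye.
have [rho rho_ge0 radT] := bounded_l2rad bT T0.
(* Radius zero leaves no slack for a near-optimal admissible sequence, but then [T] is the origin
   and both sides vanish. *)
have [rho0|rho_neq0] := eqVneq rho 0.
  have TE : T = [set 0] by apply: l2rad_eq0 => //; rewrite radT rho0.
  rewrite (gamma_singleton _ TE) radT rho0 TE.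
  under eq_integral do rewrite sup_deviation_singleton0.
  rewrite integral0 adde0 mule0; split=> // u _.
  apply: sure_event_bound => //; apply/seteqP; split => w //= _.
  by rewrite sup_deviation_singleton0 mule0 adde0 mule0.
have rho0 : 0 < rho by rewrite lt_neqAle eq_sym rho_neq0.
(* With at least one column, [psi_bound_gt0] applies; with no column every vector is zero,
   contradicting the positive radius. *)
have K0 : 0 < K.
  case: n => [|n] in A T mA indA meanA normA psiA bT T0 radT *; last first.
    exact: (psi_bound_gt0 (i := ord0) alpha0 mA normA (psiA ord0)).
  have [t Tt] := T0.
  have : (l2rad T <= 0)%E.
    apply: ge_ereal_sup => _ [s _ <-].
    by rewrite /l2norm /dotv big_ord0 sqrtr0.
  by rewrite radT lee_fin leNgt rho0.
split=> [|u u0].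
  exact: (expectation_bound_main alpha0 alpha2 mA indA meanA normA psiA K0 T0 rho0 radT).
exact: (tail_bound_main alpha0 alpha2 mA indA meanA normA psiA K0 T0 rho0 radT u0).
Qed.
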